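(* Let $G$ be a graph that is not $3$-connected and is minor-minimal with respect to having maximum matching width at least $3$ (i.e., $\operatorname{mmw}(G)\ge3$ but every proper minor of $G$ has maximum matching width at most $2$). If a $2$-cut $\{a,b\}$ of $G$ is such that $G\setminus\{a,b\}$ has exactly two components $A$ and $B$, then $ab\notin E(G)$ and one of $\tilde A=G[V(A)\cup\{a,b\}]$ and $\tilde B=G[V(B)\cup\{a,b\}]$ is isomorphic to $P_3$ or to $P_4$.
   Context: All graphs are finite and simple. $P_n$ is the path on $n$ vertices. A graph is $k$-connected if it has at least $k$ vertices and remains connected after deleting any fewer than $k$ vertices. A $2$-cut of $G$ is an inclusion-wise minimal set $S\subset V(G)$ with $|S|=2$ such that $G\setminus S$ is disconnected. A minor of $G$ is a graph obtained by deleting vertices, deleting edges and contracting edges. $\operatorname{mmw}(G)$ is the maximum matching width: the minimum, over branch-decompositions $(T,\mathcal{L})$ of $V(G)$ (with $T$ a tree all of whose vertices have degree $1$ or $3$ and $\mathcal{L}$ a bijection from its leaves to $V(G)$), of the maximum over edges $e$ of $T$ of the size of a maximum matching in $G$ among edges crossing the vertex partition induced by $e$. *)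

(* Defs.v *)
From Stdlib Require Import Relation_Operators.
From HB Require Import structures.
From mathcomp Require Import all_boot.
From mathcomp Require Import boolp.

Set Implicit Arguments.
Unset Strict Implicit.
Unset Printing Implicit Defensive.

Record sgraph := SGraph {
  vert :> finType;
  adj : rel vert;
  adj_sym : symmetric adj;
  adj_irrefl : irreflexive adj
}.

Section Constructions.
Variable G : sgraph.

Section Induced.
Variable S : {set G}.
Definition induced_adj : rel {x : G | x \in S} :=
  fun u v => adj (val u) (val v).
Lemma induced_sym : symmetric induced_adj.
Proof. by move=> u v; rewrite /induced_adj adj_sym. Qed.
Lemma induced_irrefl : irreflexive induced_adj.
Proof. by move=> u; rewrite /induced_adj adj_irrefl. Qed.
Definition induced : sgraph := SGraph induced_sym induced_irrefl.
End Induced.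

Definition del_verts (S : {set G}) : sgraph := induced (~: S).

Section Edge.
Variables x y : G.

Definition del_edge_adj : rel G :=
  fun u v => adj u v && ([set u; v] != [set x; y]).
Lemma del_edge_sym : symmetric del_edge_adj.
Proof. by move=> u v; rewrite /del_edge_adj adj_sym setUC. Qed.
Lemma del_edge_irrefl : irreflexive del_edge_adj.
Proof. by move=> u; rewrite /del_edge_adj adj_irrefl. Qed.
Definition del_edge : sgraph := SGraph del_edge_sym del_edge_irrefl.

(* y is merged into x: the vertex x of the contracted graph also receives
   the neighbours of y; loops and parallel edges disappear. *)
Definition contract_adj : rel {z : G | z != y} :=
  fun u v => (u != v) &&
    [|| adj (val u) (val v),
        (val u == x) && adj y (val v) |
        (val v == x) && adj (val u) y].
Lemma contract_sym : symmetric contract_adj.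
Proof.
move=> u v; rewrite /contract_adj eq_sym adj_sym; congr (_ && (_ || _)).
by rewrite orbC (adj_sym y) (adj_sym _ y).
Qed.
Lemma contract_irrefl : irreflexive contract_adj.
Proof. by move=> u; rewrite /contract_adj eqxx. Qed.
Definition contract : sgraph := SGraph contract_sym contract_irrefl.
End Edge.

End Constructions.

Definition iso (G H : sgraph) : Prop :=
  exists f : G -> H, bijective f /\ forall x y, adj (f x) (f y) = adj x y.

Section Path.
Variable n : nat.
Definition path_adj : rel 'I_n := fun i j => (i.+1 == j) || (j.+1 == i).
Lemma path_adj_sym : symmetric path_adj.
Proof. by move=> i j; rewrite /path_adj orbC. Qed.
Lemma path_adj_irrefl : irreflexive path_adj.
Proof. by move=> i; rewrite /path_adj orbb eqn_leq ltnn. Qed.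
Definition path_graph : sgraph := SGraph path_adj_sym path_adj_irrefl.
End Path.

Inductive minor_step (G : sgraph) : sgraph -> Prop :=
| step_del_vert (x : G) : minor_step G (del_verts [set x])
| step_del_edge (x y : G) : adj x y -> minor_step G (del_edge x y)
| step_contract (x y : G) : adj x y -> minor_step G (contract x y).

(* Every step strictly decreases the number of vertices plus edges, so the
   proper minors are the graphs reached, up to isomorphism, in at least one
   step. *)
Definition proper_minor (H G : sgraph) : Prop :=
  exists H', clos_trans sgraph minor_step G H' /\ iso H' H.

Definition connected (G : sgraph) : Prop :=
  forall x y : G, connect (@adj G) x y.

Definition k_connected (k : nat) (G : sgraph) : Prop :=
  k <= #|G| /\ forall S : {set G}, #|S| < k -> connected (del_verts S).

Definition two_cut (G : sgraph) (S : {set G}) : Prop :=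
  [/\ #|S| = 2,
      ~ connected (del_verts S) &
      forall S' : {set G}, S' \proper S -> connected (del_verts S')].

Definition components (G : sgraph) : {set {set G}} :=
  equivalence_partition (connect (@adj G)) [set: G].

Definition degree (G : sgraph) (x : G) : nat := #|[set y | adj x y]|.

Definition is_tree (T : sgraph) : Prop :=
  [/\ 0 < #|T|, connected T &
      forall c : seq T, 2 < size c -> ~ ucycle (@adj T) c].

Definition leaf (T : sgraph) := {t : T | degree t == 1}.

Record branch_decomp (G : sgraph) := BranchDecomp {
  bd_tree : sgraph;
  bd_treeP : is_tree bd_tree;
  bd_degree : forall t : bd_tree, degree t = 1 \/ degree t = 3;
  bd_map : leaf bd_tree -> G;
  bd_bij : bijective bd_map
}.

(* One part of the bipartition of the vertices of G induced by the tree edge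
   st: those whose leaf lies in the component of T - st containing s. *)
Definition bd_side (G : sgraph) (D : branch_decomp G) (s t : bd_tree D) :
    {set G} :=
  [set bd_map l | l : leaf (bd_tree D) &
     connect (@adj (del_edge s t)) s (val l)].

Definition edges (G : sgraph) : {set {set G}} :=
  [set [set p.1; p.2] | p : G * G & adj p.1 p.2].

Definition crossing_edges (G : sgraph) (S : {set G}) : {set {set G}} :=
  [set e in edges G | (e :&: S != set0) && (e :&: ~: S != set0)].

Definition max_crossing_matching (G : sgraph) (S : {set G}) : nat :=
  \max_(M : {set {set G}} | (M \subset crossing_edges S) && trivIset M) #|M|.

Definition bd_width (G : sgraph) (D : branch_decomp G) : nat :=
  \max_(p : bd_tree D * bd_tree D | adj p.1 p.2)
     max_crossing_matching (bd_side p.1 p.2).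

(* A graph on at most one vertex has no branch-decomposition, since the tree
   has an edge; its mmw is 0.  All other graphs have one. *)
Definition mmw (G : sgraph) : nat :=
  if pselect (exists k, `[< exists D : branch_decomp G, bd_width D = k >])
  is left h then ex_minn h else 0.

(* Main.v *)
Require Import Defs.
From mathcomp Require Import all_boot.
From mathcomp Require Import boolp.

(* A graph has mmw at most k (k > 0) iff it has a representation: a tree of
   maximum degree 3 whose edges carry bags of at most k vertices such that each
   vertex labels a nonempty subtree and adjacent vertices label subtrees sharing
   a node.  A representation comes from a branch-decomposition by taking, for
   every cut, a minimum vertex cover (König), chosen canonically so that
   submodularity makes the labels connected.

   Let {a, b} separate A from B.  If both G[A + a + b] and G[B + a + b] have a
   representation of width 2 with an edge carrying exactly a and b, then the two
   can be joined along it, and G has mmw at most 2.  Such an edge can be created: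
   - when the subtrees of a and b are disjoint, by merging the labels of B into
     a on one side of an edge between them and into b on the other side; this
     applied to G - ab shows that ab is not an edge;
   - when the subtrees of a and b meet and B has been split into connected parts
     X and Y with a - X - Y - b, because the three edges at a common node cannot
     carry a, b, X and Y together with three further labels.
   If B + a + b is neither P3 nor P4, either such a split survives in G/e or
   G - e for some edge e, or B is attached to {a, b} through a single vertex,
   at which representations of two proper minors can be joined. *)

Set Implicit Arguments.
Unset Strict Implicit.
Unset Printing Implicit Defensive.

(** * Trees with labelled edges *)

(** Branch-decompositions are awkward to combine: optimal covers of different cuts are unrelated,
    and one side of a separation inherits no decomposition with a prescribed cut. A representation
    is restricted to a subgraph by forgetting labels, is glued along a bag, and sees a connected
    vertex set as one subtree, which is how a whole part of B acts as a single label. Bags sit on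
    edges while adjacency is tested at nodes, so in width 2 a node offers 3 times 2 places; the case
    where a and b meet rests on this count. The two sides play crossed roles: the labels of B in a
    representation of a proper minor are spent on freeing places, and what they produce is the edge
    carrying a and b for A + a + b. A hypothesis on the shape of B thus yields the rooted
    representation of the side of A. On the way back to branch-decompositions the nodes become leaf
    sets of a laminar family, because the tree must be a graph on a finite type with all degrees 1
    or 3. *)

(* A rooted subcubic tree with labelled edges.  [Br C l r] is an edge with bag
   [C]; [l] and [r] are the (possibly absent) edges at its lower end. *)
Inductive ptree (V : finType) :=
  PNil | Br (C : {set V}) (l r : ptree V).
Arguments PNil {V}.

Section Ptree.
Variable V : finType.
Implicit Types (S T C W X Y Z : {set V}) (t l r : ptree V).

Definition meets C S := C :&: S != set0.

Lemma meets1 C u : meets C [set u] = (u \in C).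
Proof.
apply/set0Pn/idP => [[x /setIP[xC /set1P <-]]//|uC].
by exists u; rewrite !inE uC eqxx.
Qed.

Lemma meetsU C S T : meets C (S :|: T) = meets C S || meets C T.
Proof. by rewrite /meets setIUr setU_eq0 negb_and. Qed.

Lemma meets0 S : meets set0 S = false.
Proof. by rewrite /meets set0I eqxx. Qed.

Lemma meetsS C S T : S \subset T -> meets C S -> meets C T.
Proof. by move/setUidPr=> <-; rewrite meetsU => ->. Qed.

Lemma meetsP C S : reflect (exists2 x, x \in C & x \in S) (meets C S).
Proof.
apply: (iffP (set0Pn _)) => [[x /setIP[]]|[x xC xS]]; first by exists x.
by exists x; rewrite inE xC.
Qed.

Definition top t := if t is Br C _ _ then C else set0.

Fixpoint occ S t :=
  if t is Br C l r then [|| meets C S, occ S l | occ S r] else false.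

(* [conn S t]: the edges of [t] whose bag meets [S] form a (possibly empty)
   subtree.  [tconn S t]: moreover, if there are any, the root edge is one. *)
Fixpoint tconn S t :=
  if t is Br C l r then
    if meets C S then tconn S l && tconn S r else ~~ occ S l && ~~ occ S r
  else true.

Fixpoint conn S t :=
  if t is Br C l r then
    if meets C S then tconn S l && tconn S r else
    [|| conn S l && ~~ occ S r, conn S r && ~~ occ S l | tconn S l && tconn S r]
  else true.

Definition at_ S C l r := [|| meets C S, meets (top l) S | meets (top r) S].

(** Sharing a node is weaker than sharing a bag: the labels may lie on different edges among the
    three at the lower end of an edge. The upper end of the root edge adds nothing, its only edge
    being seen from below. *)
Fixpoint touch S T t :=
  if t is Br C l r then
    [|| at_ S C l r && at_ T C l r, touch S T l | touch S T r]
  else false.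

Fixpoint wide k t :=
  if t is Br C l r then [&& #|C| <= k, wide k l & wide k r] else true.

Lemma top_occ S t : meets (top t) S -> occ S t.
Proof. by case: t => [|C l r] /=; rewrite ?meets0 // => ->. Qed.

Lemma tconn_occ S t : tconn S t -> occ S t -> meets (top t) S.
Proof. by case: t => [|C l r] //=; case: ifP => //= _ /andP[/negPf-> /negPf->]. Qed.

Lemma nocc_tconn S t : ~~ occ S t -> tconn S t.
Proof. by case: t => [|C l r] //=; rewrite !negb_or => /and3P[/negPf-> -> ->]. Qed.

Lemma tconn_conn S t : tconn S t -> conn S t.
Proof.
elim: t => [|C l IHl r IHr] //=; case: ifP => // _ /andP[nl nr].
by rewrite !nocc_tconn // !orbT.
Qed.

Lemma conn_top S t : conn S t -> meets (top t) S -> tconn S t.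
Proof. by case: t => [|C l r] //= + mC; rewrite mC. Qed.

Lemma touch_occl S T t : touch S T t -> occ S t.
Proof.
elim: t => [|C l IHl r IHr] //= /or3P[/andP[/or3P[->|/top_occ->|/top_occ->] _]|/IHl->|/IHr->];
  by rewrite ?orbT.
Qed.

Lemma touchC S T t : touch S T t = touch T S t.
Proof. by elim: t => [|C l IHl r IHr] //=; rewrite IHl IHr andbC. Qed.

Lemma touch_occr S T t : touch S T t -> occ T t.
Proof. by rewrite touchC; apply: touch_occl. Qed.

Lemma touchS S S' T t : S \subset S' -> touch S T t -> touch S' T t.
Proof.
move=> sSS; elim: t => [|C l IHl r IHr] //= /or3P[/andP[/or3P H ->]|/IHl->|/IHr->];
  rewrite ?orbT // andbT.
by apply/or3P; apply: Or31; case: H => /(meetsS sSS) H; rewrite /at_ H ?orbT.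
Qed.

Lemma occU S T t : occ (S :|: T) t = occ S t || occ T t.
Proof.
elim: t => [|C l IHl r IHr] //=; rewrite meetsU IHl IHr.
by rewrite [(occ S l || _) || _]orbACA orbACA.
Qed.

(* The possible values of [meets (top t) S], [occ S t], [tconn S t] and
   [conn S t]. *)
Variant pspec : bool -> bool -> bool -> bool -> Prop :=
| PNone : pspec false false true true
| PTop : pspec true true true true
| PTopBad : pspec true true false false
| PBelow : pspec false true false true
| PBelowBad : pspec false true false false.

(** Five of the sixteen Boolean patterns survive, so connectivity claims about finitely many
    subtrees become finite case checks. *)
Lemma pspecP S t :
  pspec (meets (top t) S) (occ S t) (tconn S t) (conn S t).
Proof.
move: (@top_occ S t) (@tconn_conn S t) (@conn_top S t) (@tconn_occ S t)
  (@nocc_tconn S t).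
by case: meets; case: occ; case: tconn; case: conn => a b c d e;
  first [by constructor | by have := a isT | by have := b isT
        | by have := c isT isT | by have := d isT isT | by have := e isT].
Qed.

Lemma tconnU S T t : tconn S t -> tconn T t -> tconn (S :|: T) t.
Proof.
elim: t => [|C l IHl r IHr] //=; rewrite meetsU !occU.
case: (meets C S) => /= /andP[sl sr]; case: (meets C T) => /= /andP[tl tr].
- by rewrite IHl ?IHr //.
- by rewrite IHl ?IHr // nocc_tconn.
- by rewrite IHl ?IHr // nocc_tconn.
- by rewrite (negPf sl) (negPf sr) (negPf tl).
Qed.

Lemma tconn_connU S T t :
  tconn S t -> conn T t -> touch S T t -> tconn (S :|: T) t.
Proof.
elim: t => [|C l IHl r IHr] //=; rewrite meetsU !occU.
case mS: (meets C S) => /= /andP[sl sr]; last first.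
  rewrite /at_ mS /=.
  have mtl: meets (top l) S = false by apply: contraNF sl; apply: top_occ.
  have mtr: meets (top r) S = false by apply: contraNF sr; apply: top_occ.
  rewrite mtl mtr /= => _ /orP[/touch_occl|/touch_occl] h.
    by rewrite h in sl.
  by rewrite h in sr.
case mT: (meets C T) => /=.
  by case/andP=> tl tr _; rewrite !tconnU //.
case/or3P => [/andP[cl nr]|/andP[cr nl]|/andP[tl tr] _]; last by rewrite !tconnU //.
- rewrite (tconnU sr (nocc_tconn nr)) andbT /at_ mT /=.
  case/or3P => [/andP[_ /orP[h|/top_occ h]]|h|/touch_occr h].
  + by apply: tconnU => //; apply: conn_top.
  + by rewrite h in nr.
  + exact: IHl.
  + by rewrite h in nr.
- rewrite (tconnU sl (nocc_tconn nl)) /= /at_ mT /=.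
  case/or3P => [/andP[_ /orP[/top_occ h|h]]|/touch_occr h|h].
  + by rewrite h in nl.
  + by apply: tconnU => //; apply: conn_top.
  + by rewrite h in nl.
  + exact: IHr.
Qed.

Lemma conn_at S C l r :
  conn S (Br C l r) -> at_ S C l r -> tconn S l && tconn S r.
Proof.
rewrite /at_ /=; case: (meets C S) => //=.
case/or3P => [/andP[cl nr]|/andP[cr nl]|//] /orP[h|h].
- by rewrite conn_top ?nocc_tconn.
- by rewrite (top_occ h) in nr.
- by rewrite (top_occ h) in nl.
- by rewrite nocc_tconn ?conn_top.
Qed.

Lemma conn_occl S C l r :
  conn S (Br C l r) -> occ S l ->
  conn S l && ~~ occ S r && ~~ meets C S || tconn S l && tconn S r.
Proof.
rewrite /=; case: (meets C S) => /= [->|]; first by rewrite orbT.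
by case/or3P => [->//|/andP[_ /negPf->]//|->]; rewrite orbT.
Qed.

Lemma conn_brC S C l r : conn S (Br C l r) = conn S (Br C r l).
Proof. by rewrite /= orbCA (andbC (tconn S l)). Qed.

(** At a shared node an edge of one subtree is equal or adjacent to an edge of the other. *)
Lemma connU S T t : conn S t -> conn T t -> touch S T t -> conn (S :|: T) t.
Proof.
elim: t => [|C l IHl r IHr] // cS cT.
have half l' r' :
   (conn S l' -> conn T l' -> touch S T l' -> conn (S :|: T) l') ->
   conn S (Br C l' r') -> conn T (Br C l' r') -> touch S T l' ->
   conn (S :|: T) (Br C l' r').
  move=> IH {}cS {}cT h.
  have /orP[/andP[/andP[sl sr] mS]|/andP[sl sr]] := conn_occl cS (touch_occl h);
  have /orP[/andP[/andP[tl tr] mT]|/andP[tl tr]] := conn_occl cT (touch_occr h).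
  - rewrite /= meetsU (negPf mS) (negPf mT) /= IH // occU.
    by rewrite (negPf sr) (negPf tr).
  - rewrite /= !(tconnU (nocc_tconn sr) tr) (setUC S) tconn_connU // ?orbT ?if_same //.
    by rewrite touchC.
  - by rewrite /= (tconnU sr (nocc_tconn tr)) tconn_connU // ?orbT ?if_same.
  - by rewrite /= !tconnU // ?orbT ?if_same.
case/or3P => [/andP[/(conn_at cS)/andP[sl sr] /(conn_at cT)/andP[tl tr]]|h|h].
- by rewrite /= !tconnU // ?orbT ?if_same.
- exact: half.
- by rewrite conn_brC; apply: half => //; rewrite conn_brC.
Qed.

End Ptree.

(** * Moving the viewpoint in an unrooted tree *)

Section View.
Variable V : finType.
Implicit Types (S T C W X Y Z : {set V}) (t l r : ptree V).

(* An unrooted tree seen from one of its vertices: the (at most three) rooted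
   trees hanging there. *)
Definition view := (ptree V * ptree V * ptree V)%type.
Implicit Types v : view.

Definition wide3 k v := let: (t1, t2, t3) := v in
  [&& wide k t1, wide k t2 & wide k t3].
Definition occ3 S v := let: (t1, t2, t3) := v in
  [|| occ S t1, occ S t2 | occ S t3].
Definition at3 S v := let: (t1, t2, t3) := v in
  [|| meets (top t1) S, meets (top t2) S | meets (top t3) S].
Definition touch3 S T v := let: (t1, t2, t3) := v in
  [|| at3 S v && at3 T v, touch S T t1, touch S T t2 | touch S T t3].
Definition conn3 S v := let: (t1, t2, t3) := v in
  [|| [&& conn S t1, ~~ occ S t2 & ~~ occ S t3],
      [&& conn S t2, ~~ occ S t1 & ~~ occ S t3],
      [&& conn S t3, ~~ occ S t1 & ~~ occ S t2] |
      [&& tconn S t1, tconn S t2 & tconn S t3]].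

(** Stands for the two views showing one unrooted tree: only the quantities that do not depend on
    the viewpoint are compared. *)
Definition same v w :=
  [/\ forall k, wide3 k v = wide3 k w, forall S, occ3 S v = occ3 S w,
      forall S, conn3 S v = conn3 S w & forall S T, touch3 S T v = touch3 S T w].

Lemma same_refl v : same v v. Proof. by []. Qed.

Lemma same_trans v w x : same v w -> same w x -> same v x.
Proof.
case=> a1 a2 a3 a4 [b1 b2 b3 b4]; split=> *;
  by rewrite ?a1 ?a2 ?a3 ?a4 ?b1 ?b2 ?b3 ?b4.
Qed.

Ltac bash S t := case: (pspecP S t).

Lemma same_rot t1 t2 t3 : same (t1, t2, t3) (t2, t3, t1).
Proof.
split=> [k|S|S|S T] /=.
- by case: (wide k t1); case: (wide k t2); case: (wide k t3).
- by case: (occ S t1); case: (occ S t2); case: (occ S t3).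
- by bash S t1; bash S t2; bash S t3.
- rewrite [meets (top t1) S || _]orbC [meets (top t1) T || _]orbC -!orbA.
  by case: (_ && _) => //=; rewrite orbC -!orbA.
Qed.

Lemma same_swap t1 t2 t3 : same (t1, t2, t3) (t1, t3, t2).
Proof.
split=> [k|S|S|S T] /=.
- by rewrite (andbC (wide k t2)).
- by rewrite (orbC (occ S t2)).
- by bash S t1; bash S t2; bash S t3.
- by rewrite (orbC (meets (top t2) S)) (orbC (meets (top t2) T)) (orbC (touch S T t2)).
Qed.

(** The viewpoint crosses the edge [C]; from its lower end, the two former siblings hang behind
    [C]. *)
Lemma same_move C l r t2 t3 : same (Br C l r, t2, t3) (Br C t2 t3, l, r).
Proof.
split=> [k|S|S|S T] /=.
- by case: (_ <= k) => //=; rewrite andbC.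
- by case: (meets C S) => //=; rewrite orbC.
- case: (meets C S) => //=.
  + by bash S l; bash S r; bash S t2; bash S t3.
  + by bash S l; bash S r; bash S t2; bash S t3.
- rewrite /at_; case: (_ && _); case: (_ && _) => //=; rewrite ?orbT //.
  by rewrite orbC.
Qed.

Lemma same_movel C l r t2 t3 : same (Br C l r, t2, t3) (l, r, Br C t2 t3).
Proof. exact: same_trans (same_move _ _ _ _ _) (same_rot _ _ _). Qed.

Lemma same_mover C l r t2 t3 : same (Br C l r, t2, t3) (r, Br C t2 t3, l).
Proof. exact: same_trans (same_movel _ _ _ _ _) (same_rot _ _ _). Qed.

Lemma nav_at S t1 t2 t3 : occ S t1 ->
  exists2 v, same (t1, t2, t3) v & at3 S v.
Proof.
elim: t1 t2 t3 => [|C l IHl r IHr] t2 t3 //= /or3P[m|o|o].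
- by exists (Br C l r, t2, t3); rewrite //= m.
- have [v sv av] := IHl r (Br C t2 t3) o.
  by exists v => //; apply: same_trans sv; apply: same_movel.
- have [v sv av] := IHr (Br C t2 t3) l o.
  by exists v => //; apply: same_trans sv; apply: same_mover.
Qed.

Lemma nav_touch S T t1 t2 t3 : touch S T t1 ->
  exists2 v, same (t1, t2, t3) v & at3 S v && at3 T v.
Proof.
elim: t1 t2 t3 => [|C l IHl r IHr] t2 t3 //= /or3P[m|o|o].
- by exists (Br C t2 t3, l, r) => //; apply: same_move.
- have [v sv av] := IHl r (Br C t2 t3) o.
  by exists v => //; apply: same_trans sv; apply: same_movel.
- have [v sv av] := IHr (Br C t2 t3) l o.
  by exists v => //; apply: same_trans sv; apply: same_mover.
Qed.

Lemma conn3_at S t1 t2 t3 : conn3 S (t1, t2, t3) -> at3 S (t1, t2, t3) ->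
  [&& tconn S t1, tconn S t2 & tconn S t3].
Proof. by rewrite /=; bash S t1; bash S t2; bash S t3. Qed.

(** Walk from a node carrying [S] towards [T] as long as the edge ahead carries [S]. No node on the
    way carries [T], for it would be shared; the first edge without [S] therefore carries neither,
    with [S] behind it and [T] ahead. *)
Lemma nav_sep S T t1 t2 t3 : conn3 S (t1, t2, t3) -> conn3 T (t1, t2, t3) ->
  ~~ touch3 S T (t1, t2, t3) -> at3 S (t1, t2, t3) -> occ T t1 ->
  exists C l r u1 u2, [/\ same (t1, t2, t3) (Br C l r, u1, u2),
    ~~ occ S (Br C l r) & ~~ occ T (Br C u1 u2)].
Proof.
elim: t1 t2 t3 => [|C l IHl r IHr] t2 t3 // cS cT nST aS oT.
have naT : ~~ at3 T (Br C l r, t2, t3).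
  by move: nST; rewrite negb_or aS => /andP[].
have /norP[nCT _] := naT.
have noT : ~~ occ T (Br C t2 t3).
  move: cT naT oT; rewrite [occ _ (Br C t2 t3)]/= (negPf nCT) /conn3 /at3.
  by bash T (Br C l r); bash T t2; bash T t3.
have [mS|nS] := boolP (meets C S); last first.
  exists C, l, r, t2, t3; split=> //.
  have /and3P[+ _ _] := conn3_at cS aS.
  by move=> tS; apply: contra nS => /(tconn_occ tS).
have nav l' r' : same (Br C l r, t2, t3) (l', r', Br C t2 t3) ->
  (forall t2 t3 : ptree V, conn3 S (l', t2, t3) -> conn3 T (l', t2, t3) ->
   ~~ touch3 S T (l', t2, t3) -> at3 S (l', t2, t3) -> occ T l' ->
   exists C l r u1 u2, [/\ same (l', t2, t3) (Br C l r, u1, u2),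
     ~~ occ S (Br C l r) & ~~ occ T (Br C u1 u2)]) -> occ T l' ->
  exists C' l' r' u1 u2, [/\ same (Br C l r, t2, t3) (Br C' l' r', u1, u2),
    ~~ occ S (Br C' l' r') & ~~ occ T (Br C' u1 u2)].
  move=> sv IH o; have [_ _ sc st] := sv.
  have [||||C' [l1 [r1 [u1 [u2 [s1 s2 s3]]]]]] := IH r' (Br C t2 t3) _ _ _ _ o.
  - by rewrite -sc.
  - by rewrite -sc.
  - by rewrite -st.
  - by rewrite /= mS !orbT.
  by exists C', l1, r1, u1, u2; split=> //; apply: same_trans s1.
move: oT; rewrite /= (negPf nCT) /= => /orP[o|o].
- by apply: nav o => //; apply: same_movel.
- apply: nav o => //; apply: same_trans (same_mover _ _ _ _ _) _.
  exact: same_swap.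
Qed.

End View.

(** * Relabelling the bags *)

Section Map.
Variables (V V' : finType) (f : {set V} -> {set V'}).

Fixpoint tree_map t :=
  if t is Br C l r then Br (f C) (tree_map l) (tree_map r) else PNil.

Lemma wide_map k t : (forall C : {set V}, #|C| <= k -> #|f C| <= k) ->
  wide k t -> wide k (tree_map t).
Proof. by move=> fk; elim: t => [|C l IHl r IHr] //= /and3P[/fk-> /IHl-> /IHr->]. Qed.

Section Eq.
Variables (S : {set V}) (S' : {set V'}).
Hypothesis fS : forall C, meets (f C) S' = meets C S.

Lemma top_map t : meets (top (tree_map t)) S' = meets (top t) S.
Proof. by case: t => [|C l r] //=; rewrite !meets0. Qed.

Lemma occ_map t : occ S' (tree_map t) = occ S t.
Proof. by elim: t => [|C l IHl r IHr] //=; rewrite fS IHl IHr. Qed.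

Lemma tconn_map t : tconn S' (tree_map t) = tconn S t.
Proof. by elim: t => [|C l IHl r IHr] //=; rewrite fS IHl IHr !occ_map. Qed.

Lemma conn_map t : conn S' (tree_map t) = conn S t.
Proof. by elim: t => [|C l IHl r IHr] //=; rewrite fS IHl IHr !occ_map !tconn_map. Qed.
End Eq.

Lemma touch_map (S T : {set V}) (S' T' : {set V'}) t :
  (forall C, meets C S -> meets (f C) S') ->
  (forall C, meets C T -> meets (f C) T') ->
  touch S T t -> touch S' T' (tree_map t).
Proof.
move=> fS fT.
have ft (Q : {set V}) (Q' : {set V'}) u : (forall C, meets C Q -> meets (f C) Q') ->
    meets (top u) Q -> meets (top (tree_map u)) Q'.
  by move=> fQ; case: u => [|C l r] /=; [rewrite meets0|apply: fQ].
elim: t => [|C l IHl r IHr] //= /or3P[/andP[/or3P aS /or3P aT]|/IHl->|/IHr->];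
  rewrite ?orbT //.
apply/or3P/Or31; apply/andP; split; apply/or3P.
- by case: aS => [/fS|/(ft _ _ _ fS)|/(ft _ _ _ fS)] ->;
    [apply: Or31|apply: Or32|apply: Or33].
- by case: aT => [/fT|/(ft _ _ _ fT)|/(ft _ _ _ fT)] ->;
    [apply: Or31|apply: Or32|apply: Or33].
Qed.
End Map.

(** * Tree representations *)

Section Rep.
Variable V : finType.
Implicit Types (S T C K W X Y Z : {set V}) (t l r : ptree V) (E : rel V).

(** Vertices outside [W] may remain in the bags: they use up width but need not form subtrees. The
    same tree thus represents every subgraph, and the labels dropped from [W] can still be exploited
    later. *)
Definition rep k t W E :=
  [/\ wide k t, {in W, forall w, occ [set w] t && conn [set w] t} &
      {in W &, forall u w, E u w -> touch [set u] [set w] t}].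

Definition rooted k K W E :=
  exists t, [/\ rep k t W E, top t = K & forall w, w \notin W -> ~~ occ [set w] t].

(** Connectedness of [X] by cuts instead of paths: it speaks of a relation on the ambient type, so
    it passes to minors without induced subgraphs. The empty set qualifies. *)
Definition cut_connected E X :=
  forall U, U != set0 -> U \proper X -> exists2 u, u \in U &
    exists2 w, w \in X :\: U & E u w.

(** A maximal nonempty subset of [X] whose edges form a subtree could be enlarged along any edge
    leaving it inside [X]. *)
Lemma conn_set k t W E X : rep k t W E -> X \subset W -> X != set0 ->
  cut_connected E X -> conn X t.
Proof.
move=> [_ cW eW] XW /set0Pn[x xX] cX.
pose P U := [&& U != set0, U \subset X & conn U t].
have [|U /maxsetP[/and3P[U0 UX cU] maxU] _] := @maxset_exists _ P [set x].
  rewrite /P sub1set xX -cards_eq0 cards1 /=.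
  by have /andP[_ ->] := cW _ (subsetP XW _ xX).
have [->//|nUX] := eqVneq X U.
have [|u uU [w]] := cX U U0; first by rewrite properEneq eq_sym nUX.
case/setDP => wX wU Euw; case/negP: (wU).
rewrite -(maxU (U :|: [set w])) ?inE ?eqxx ?orbT ?subsetUl //.
have uX := subsetP UX _ uU.
apply/and3P; split.
- by apply/set0Pn; exists u; rewrite inE uU.
- by rewrite subUset UX sub1set.
- apply: connU => //.
    by have /andP[] := cW _ (subsetP XW _ wX).
  apply: (@touchS _ [set u]); rewrite ?sub1set //.
  by apply: eW; rewrite ?(subsetP XW).
Qed.

(** All of [K] lies on the new edge, so adjacency inside [K] comes for free; a vertex outside [K]
    occurs in one of the two trees only. *)
Lemma rooted_glue k K W1 W2 E : #|K| <= k -> K \subset W1 -> K \subset W2 ->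
  W1 :&: W2 \subset K -> rooted k K W1 E -> rooted k K W2 E ->
  exists t, rep k t (W1 :|: W2)
    (fun u w => E u w && ((u \in W1) && (w \in W1) || (u \in W2) && (w \in W2))
       || (u \in K) && (w \in K)).
Proof.
move=> Kk K1 K2 WK [t1 [[w1 c1 e1] T1 n1]] [t2 [[w2 c2 e2] T2 n2]].
exists (Br K t1 t2); split.
- by rewrite /= Kk w1 w2.
- move=> w; rewrite inE /= meets1 => wW.
  have [wK|wK] := boolP (w \in K).
    have /andP[_ cw1] := c1 _ (subsetP K1 _ wK).
    have /andP[_ cw2] := c2 _ (subsetP K2 _ wK).
    by rewrite /= !conn_top ?T1 ?T2 ?meets1.
  have nW : ~~ ((w \in W1) && (w \in W2)).
    by apply: contra wK => h; apply: (subsetP WK); rewrite inE.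
  case/orP: wW nW => wW; rewrite wW /= ?andbT => nW.
    by have /andP[-> ->] := c1 _ wW; rewrite (n2 _ nW).
  by have /andP[-> ->] := c2 _ wW; rewrite (n1 _ nW) !orbT.
- move=> u w _ _ /orP[/andP[Euw /orP[]/andP[uW wW]]|/andP[uK wK]] /=; last first.
  - by rewrite /at_ !meets1 uK wK.
  - by rewrite (e2 _ _ uW wW Euw) !orbT.
  - by rewrite (e1 _ _ uW wW Euw) orbT.
Qed.

Definition rep3 k (v : view V) W E :=
  [/\ wide3 k v, {in W, forall w, occ3 [set w] v && conn3 [set w] v} &
      {in W &, forall u w, E u w -> touch3 [set u] [set w] v}].

Lemma conn3_root S t : conn3 S (t, PNil, PNil) = conn S t.
Proof. by rewrite /=; case: (pspecP S t). Qed.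

Lemma touch3_root S T t : touch3 S T (t, PNil, PNil) = touch S T t.
Proof.
case: t => [|C l r] /=; rewrite ?meets0 //= !orbF.
by rewrite /at_; case: (meets C S); case: (meets C T).
Qed.

Lemma rep3_root k t W E v : rep k t W E -> same (t, PNil, PNil) v -> rep3 k v W E.
Proof.
case=> wt cW eW [sw so sc st]; split.
- by rewrite -sw /= wt.
- by move=> w wW; rewrite -so -sc conn3_root /= orbF; apply: cW.
- by move=> u w uW wW Euw; rewrite -st touch3_root ?eW.
Qed.

Lemma meetsI1 C W w : w \in W -> meets (C :&: W) [set w] = meets C [set w].
Proof. by move=> wW; rewrite !meets1 inE wW andbT. Qed.

Definition restrict W := tree_map (fun C => C :&: W).

Lemma wide_restrict k W t : wide k t -> wide k (restrict W t).
Proof.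
apply: wide_map => C; apply: leq_trans.
by rewrite subset_leq_card ?subsetIl.
Qed.

Lemma nocc_restrict W t w : w \notin W -> ~~ occ [set w] (restrict W t).
Proof.
move=> wW; elim: t => [|C l IHl r IHr] //=.
by rewrite !negb_or IHl IHr meets1 inE (negPf wW) andbF.
Qed.

Lemma touch_restrict W u w t : u \in W -> w \in W ->
  touch [set u] [set w] t -> touch [set u] [set w] (restrict W t).
Proof. by move=> uW wW; apply: touch_map => C; rewrite meetsI1. Qed.

Lemma touchE S T C l r : touch S T (Br C l r) =
  [|| at_ S C l r && at_ T C l r, touch S T l | touch S T r].
Proof. by []. Qed.

Lemma connE S C l r : conn S (Br C l r) =
  if meets C S then tconn S l && tconn S r else
  [|| conn S l && ~~ occ S r, conn S r && ~~ occ S l | tconn S l && tconn S r].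
Proof. by []. Qed.

Lemma occE S C l r : occ S (Br C l r) = [|| meets C S, occ S l | occ S r].
Proof. by []. Qed.

(** Subdivide the edge [C]: the half at the viewed node gets the bag [K], and a pendant edge with
    bag [K] hangs at the new node. The labels of [K] stay connected because all are present at the
    viewed node, and [C] carried no other label of [W]. *)
Lemma rooted_restrict_edge k K W E C l r t2 t3 :
  rep3 k (Br C l r, t2, t3) W E -> #|K| <= k -> K \subset W ->
  C :&: W \subset K ->
  {in K, forall x, at3 [set x] (Br C l r, t2, t3)} -> rooted k K W E.
Proof.
case=> wt cW eW Kk KW CK aK.
exists (Br K (Br K (restrict W t2) (restrict W t3)) (restrict W (Br C l r))).
split=> //; last first.
  move=> w wW; have nK : w \notin K by apply: contra wW; apply: (subsetP KW).
  rewrite [occ _ (Br _ _ _)]/= !meets1 (negPf nK) inE (negPf wW) andbF /=.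
  by rewrite !negb_or !nocc_restrict.
split.
- move/and3P: wt => [/= /and3P[wC wl wr] w2 w3].
  rewrite Kk !wide_restrict //= andbT.
  by apply: leq_trans wC; rewrite subset_leq_card ?subsetIl.
- move=> w wW.
  have f C' := meetsI1 C' wW.
  have /andP[ow cw] := cW _ wW.
  have [wK|wK] := boolP (w \in K).
    have /and3P[c1 c2 c3] := conn3_at cw (aK _ wK).
    rewrite [occ _ _]/= meets1 wK /= meets1 wK.
    by rewrite !(tconn_map f) !(occ_map f) c2 c3 /= f.
  have nC : ~~ meets C [set w].
    apply: contra wK; rewrite meets1 => wC; apply: (subsetP CK).
    by rewrite inE wC.
  move: ow cw; rewrite [occ _ _]/= [conn _ _]/= !meets1 (negPf wK).
  rewrite !(tconn_map f) !(occ_map f) !(conn_map f).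
  rewrite /= inE -meets1 (negPf nC) /=.
  by case: (pspecP [set w] l); case: (pspecP [set w] r);
    case: (pspecP [set w] t2); case: (pspecP [set w] t3).
- move=> u w uW wW Euw.
  have {eW} := eW _ _ uW wW Euw.
  case/or4P => [/andP[au aw]|h|h|h]; last first.
  + by rewrite /= (touch_restrict _ _ h) ?orbT.
  + by rewrite /= (touch_restrict _ _ h) ?orbT.
  + by rewrite touchE (touch_restrict _ _ h) ?orbT.
  have H x : x \in W -> at3 [set x] (Br C l r, t2, t3) ->
     at_ [set x] K (restrict W t2) (restrict W t3).
    move=> xW; rewrite /at_ !(top_map (fun C => meetsI1 C xW)).
    case/or3P => [|->|->]; rewrite ?orbT //= !meets1 => xC.
    by rewrite (subsetP CK) // inE xC.
  by rewrite /= !H ?orbT.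
Qed.

Lemma three_in_two C S T z : #|C| <= 2 -> z \in C -> z \notin S -> z \notin T ->
  [disjoint S & T] -> meets C S -> meets C T -> False.
Proof.
move=> C2 zC zS zT ST /meetsP[x xC xS] /meetsP[y yC yT].
have : #|[set x; y; z]| <= 2.
  by apply: leq_trans C2; rewrite subset_leq_card // !subUset !sub1set xC yC.
have xy : x != y by apply: contraTneq yT => <-; rewrite (disjointFr ST).
have xz : x != z by apply: contraNneq zS => <-.
have yz : y != z by apply: contraNneq zT => <-.
by rewrite setUC cardsU1 cards2 xy !inE negb_or !(eq_sym z) xz yz.
Qed.


(** * Creating an edge that carries two given labels *)

Section TwoLabels.
Variables (t : ptree V) (W : {set V}) (E : rel V) (a b : V).
Hypotheses (rt : rep 2 t W E) (aW : a \in W) (bW : b \in W) (neq_ab : a != b).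

Lemma card_ab : #|[set a; b]| <= 2.
Proof. by rewrite cards2 neq_ab. Qed.

Lemma sub_ab : [set a; b] \subset W.
Proof. by rewrite subUset !sub1set aW. Qed.

(* If the subtrees of [a] and [b] share the vertex [v], and [a - X - Y - b]
   winds around, then the three edges at [v] cannot all carry a label of [W]
   other than [a] and [b]: the three remaining places would have to separate
   [a], [b], [X] and [Y]. *)
Lemma rooted_touch X Y : [disjoint X & W] -> [disjoint Y & W] ->
  [disjoint X & Y] -> conn X t -> conn Y t ->
  touch [set a] X t -> touch X Y t -> touch Y [set b] t ->
  touch [set a] [set b] t -> rooted 2 [set a; b] W E.
Proof.
move=> XW YW XY cX cY aX tXY Yb tab.
have [[[t1 t2] t3] sv /andP[ata atb]] := nav_touch PNil PNil tab.
have rv := rep3_root rt sv; have [wv cv _] := rv; case: (sv) => sw so sc st.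
have good C l r u1 u2 : same (t1, t2, t3) (Br C l r, u1, u2) ->
    at3 [set a] (Br C l r, u1, u2) -> at3 [set b] (Br C l r, u1, u2) ->
    C :&: W \subset [set a; b] -> rooted 2 [set a; b] W E.
  move=> s1 a1 b1 CW; have r1 := rep3_root rt (same_trans sv s1).
  apply: rooted_restrict_edge r1 card_ab sub_ab CW _.
  by move=> x /set2P[]->.
(* Either the top edge of [u] can be used at once, or one of its two places is taken by a label of
   [W] other than [a] and [b]; the remaining place cannot serve two of the four disjoint sets. *)
have slot u : (forall C l r, u = Br C l r -> #|C| <= 2) ->
    (forall C l r, u = Br C l r -> C :&: W \subset [set a; b] ->
       rooted 2 [set a; b] W E) ->
    rooted 2 [set a; b] W E \/
    forall S T, S \in [:: [set a]; [set b]; X; Y] ->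
       T \in [:: [set a]; [set b]; X; Y] -> [disjoint S & T] ->
       meets (top u) S -> meets (top u) T -> False.
  case: u => [|C l r] Cw H; first by right=> S T _ _ _; rewrite meets0.
  have [CW|] := boolP (C :&: W \subset [set a; b]); first by left; apply: H CW.
  case/subsetPn => z /setIP[zC zW]; rewrite !inE negb_or => /andP[za zb]; right.
  have nz S : S \in [:: [set a]; [set b]; X; Y] -> z \notin S.
    rewrite !inE => /or4P[]/eqP->; rewrite ?inE //.
    - by rewrite (disjointFl XW zW).
    - by rewrite (disjointFl YW zW).
  move=> S T SL TL; apply: three_in_two (nz _ SL) (nz _ TL) => //.
  exact: (Cw C l r).
have /and3P[w1 w2 w3] := wv.
have wd u C l r : wide 2 u -> u = Br C l r -> #|C| <= 2 by move=> + eu; rewrite eu => /and3P[].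
have [||//|slot1] := slot t1; first by move=> *; apply: wd w1 _; eassumption.
  by move=> C l r eu; apply: (good C l r t2 t3); rewrite -eu.
have [||//|slot2] := slot t2; first by move=> *; apply: wd w2 _; eassumption.
  move=> C l r eu; apply: (good C l r t3 t1); rewrite -eu.
  - exact: same_rot.
  - by move: ata; rewrite /= orbC -orbA.
  - by move: atb; rewrite /= orbC -orbA.
have [||//|slot3] := slot t3; first by move=> *; apply: wd w3 _; eassumption.
  move=> C l r eu; apply: (good C l r t1 t2); rewrite -eu.
  - exact: same_trans (same_rot _ _ _) (same_rot _ _ _).
  - by move: ata; rewrite /= orbA orbC.
  - by move: atb; rewrite /= orbA orbC.
exfalso.
pose v := (t1, t2, t3); pose u i := nth PNil [:: t1; t2; t3] i.
have cX3 : conn3 X v by rewrite -sc conn3_root.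
have cY3 : conn3 Y v by rewrite -sc conn3_root.
have /andP[_ ca3] := cv _ aW; have /andP[_ cb3] := cv _ bW.
have at_ex S : at3 S v -> exists2 i, i < 3 & meets (top (u i)) S.
  by case/or3P => h; [exists 0|exists 1|exists 2].
have touch_ex S T : touch3 S T v -> ~~ (at3 S v && at3 T v) ->
    exists2 i, i < 3 & occ S (u i) /\ occ T (u i).
  case/or4P => [->//|h|h|h] _; [exists 0|exists 1|exists 2] => //;
    by rewrite (touch_occl h) (touch_occr h).
have spread S i : conn3 S v -> at3 S v -> i < 3 -> occ S (u i) -> meets (top (u i)) S.
  move=> cS aS; have /and3P[c1 c2 c3] := conn3_at cS aS.
  by case: i => [|[|[|]]] //= _; apply: tconn_occ.
have lone S i j : conn3 S v -> ~~ at3 S v -> i < 3 -> j < 3 ->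
    occ S (u i) -> occ S (u j) -> i = j.
  rewrite /u /=; case: i j => [|[|[|i]]] [|[|[|j]]] //=;
  by case: (pspecP S t1); case: (pspecP S t2); case: (pspecP S t3).
have dab : [disjoint [set a] & [set b]] by rewrite disjoints1 inE.
have daX : [disjoint [set a] & X] by rewrite disjoints1 (disjointFl XW).
have daY : [disjoint [set a] & Y] by rewrite disjoints1 (disjointFl YW).
have dbX : [disjoint [set b] & X] by rewrite disjoints1 (disjointFl XW).
have dbY : [disjoint [set b] & Y] by rewrite disjoints1 (disjointFl YW).
have slot' S T i j : S \in [:: [set a]; [set b]; X; Y] ->
    T \in [:: [set a]; [set b]; X; Y] -> [disjoint S & T] -> i < 3 ->
    meets (top (u i)) S -> meets (top (u j)) T -> i != j.
  move=> SL TL dST i3 mS mT; apply/eqP => eij; move: mS mT; rewrite -eij.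
  case: i i3 {eij} => [|[|[|i]]] // _.
  - exact: slot1.
  - exact: slot2.
  - exact: slot3.
have L1 : [set a] \in [:: [set a]; [set b]; X; Y] by rewrite inE eqxx.
have L2 : [set b] \in [:: [set a]; [set b]; X; Y] by rewrite !inE eqxx !orbT.
have L3 : X \in [:: [set a]; [set b]; X; Y] by rewrite !inE eqxx !orbT.
have L4 : Y \in [:: [set a]; [set b]; X; Y] by rewrite !inE eqxx !orbT.
have {}aX : touch3 [set a] X v by rewrite -st touch3_root.
have {}tXY : touch3 X Y v by rewrite -st touch3_root.
have {}Yb : touch3 Y [set b] v by rewrite -st touch3_root.
(* If [X] and [Y] are both at the node, four disjoint sets compete for three places. A set absent
   from the node lies in a single branch, so its neighbours in the chain a, X, Y, b that are at the
   node enter this branch by the same top edge. If both are absent they share a branch, and [a]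
   collides with [b]. *)
have [atX|natX] := boolP (at3 X v); have [atY|natY] := boolP (at3 Y v).
- have [i i3 mi] := at_ex _ ata; have [j j3 mj] := at_ex _ atb.
  have [k k3 mk] := at_ex _ atX; have [m m3 mm] := at_ex _ atY.
  have := slot' _ _ _ _ L1 L2 dab i3 mi mj.
  have := slot' _ _ _ _ L1 L3 daX i3 mi mk.
  have := slot' _ _ _ _ L1 L4 daY i3 mi mm.
  have := slot' _ _ _ _ L2 L3 dbX j3 mj mk.
  have := slot' _ _ _ _ L2 L4 dbY j3 mj mm.
  have := slot' _ _ _ _ L3 L4 XY k3 mk mm.
  case: i i3 {mi} => [|[|[|i]]] // _; case: j j3 {mj} => [|[|[|j]]] // _;
  case: k k3 {mk} => [|[|[|k]]] // _; by case: m m3 {mm} => [|[|[|m]]].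
- have [|i i3 [oX oY]] := touch_ex _ _ tXY; first by rewrite (negPf natY) andbF.
  have [|j j3 [oY' ob]] := touch_ex _ _ Yb; first by rewrite (negPf natY).
  have := slot' _ _ _ _ L2 L3 dbX j3 (spread _ _ cb3 atb j3 ob) (spread _ _ cX3 atX i3 oX).
  by rewrite (lone _ _ _ cY3 natY i3 j3 oY oY') eqxx.
- have [|i i3 [oX oY]] := touch_ex _ _ tXY; first by rewrite (negPf natX).
  have [|j j3 [oa oX']] := touch_ex _ _ aX; first by rewrite (negPf natX) andbF.
  have := slot' _ _ _ _ L1 L4 daY j3 (spread _ _ ca3 ata j3 oa) (spread _ _ cY3 atY i3 oY).
  by rewrite (lone _ _ _ cX3 natX i3 j3 oX oX') eqxx.
- have [|i i3 [oX oY]] := touch_ex _ _ tXY; first by rewrite (negPf natX).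
  have [|j j3 [oa oX']] := touch_ex _ _ aX; first by rewrite (negPf natX) andbF.
  have [|k k3 [oY' ob]] := touch_ex _ _ Yb; first by rewrite (negPf natY).
  have := slot' _ _ _ _ L1 L2 dab j3 (spread _ _ ca3 ata j3 oa) (spread _ _ cb3 atb k3 ob).
  by rewrite -(lone _ _ _ cX3 natX i3 j3 oX oX') (lone _ _ _ cY3 natY i3 k3 oY oY') eqxx.
Qed.

Definition merge Z x C := (C :&: W) :|: (if meets C Z then [set x] else set0).

Lemma meets_merge_other Z x w C : w \in W -> w != x ->
  meets (merge Z x C) [set w] = meets C [set w].
Proof.
move=> wW wx; rewrite !meets1 !inE wW andbT.
by case: ifP; rewrite !inE ?(negPf wx) orbF.
Qed.

Lemma meets_merge Z x C : x \in W ->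
  meets (merge Z x C) [set x] = meets C ([set x] :|: Z).
Proof.
move=> xW; rewrite meetsU !meets1 !inE xW andbT.
by case: ifP; rewrite !inE ?eqxx ?orbT.
Qed.

Lemma meets_merge_out Z x w C : x \in W -> w \notin W ->
  meets (merge Z x C) [set w] = false.
Proof.
move=> xW wW; rewrite !meets1 !inE (negPf wW) andbF /=.
case: ifP; rewrite !inE //= => _.
by apply: contraNF wW => /eqP->.
Qed.

(** Whenever [x] enters a bag, some label of [Z], which is outside [W], leaves it. *)
Lemma card_merge Z x C : [disjoint Z & W] -> #|merge Z x C| <= #|C|.
Proof.
move=> ZW; rewrite /merge; case: ifP => [/meetsP[z zC zZ]|_]; last first.
  by rewrite setU0 subset_leq_card ?subsetIl.
rewrite (cardsD1 z C) zC add1n setUC.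
apply: leq_trans (leq_card_setU _ _) _; rewrite cards1 ltnS subset_leq_card //.
apply/subsetP => y /setIP[yC yW]; rewrite !inE yC andbT.
by apply: contraTneq yW => ->; rewrite (disjointFr ZW).
Qed.

Lemma touch_merge Z x u w r : x \in W -> u \in W -> w \in W ->
  touch [set u] [set w] r -> touch [set u] [set w] (tree_map (merge Z x) r).
Proof.
move=> xW; have H y : y \in W -> forall C, meets C [set y] -> meets (merge Z x C) [set y].
  move=> yW C; have [->|yx] := eqVneq y x; last by rewrite meets_merge_other.
  by rewrite meets_merge // meetsU => ->.
move=> uW wW; apply: touch_map; exact: H.
Qed.

(* Cut the tree at an edge between the subtrees of [a] and [b]; it carries a
   label of [Z], so merging [Z] into [a] on one side and into [b] on the other
   makes room for a pendant edge carrying [a] and [b]. *)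
Lemma rooted_apart Z : [disjoint Z & W] -> conn Z t ->
  touch [set a] Z t -> touch [set b] Z t ->
  ~~ touch [set a] [set b] t -> rooted 2 [set a; b] W E.
Proof.
move=> ZW cZ taZ tbZ ntab.
have ca : conn [set a] t by have [_ /(_ _ aW)/andP[]] := rt.
have cb : conn [set b] t by have [_ /(_ _ bW)/andP[]] := rt.
have oa := touch_occl taZ; have ob := touch_occl tbZ.
have [[[t1 t2] t3] sv ata] := nav_at PNil PNil oa.
have [sw so sc st] := sv.
have {}ntab : ~~ touch3 [set a] [set b] (t1, t2, t3) by rewrite -st touch3_root.
have {}ca : conn3 [set a] (t1, t2, t3) by rewrite -sc conn3_root.
have {}cb : conn3 [set b] (t1, t2, t3) by rewrite -sc conn3_root.
have [C [l [r [u1 [u2 [sv' na nb]]]]]] :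
    exists C l r u1 u2, [/\ same (t, PNil, PNil) (Br C l r, u1, u2),
      ~~ occ [set a] (Br C l r) & ~~ occ [set b] (Br C u1 u2)].
  have : occ3 [set b] (t1, t2, t3) by rewrite -so /= ob.
  have step u1 u2 u3 : same (t1, t2, t3) (u1, u2, u3) ->
      at3 [set a] (u1, u2, u3) -> occ [set b] u1 ->
      exists C l r u1 u2, [/\ same (t, PNil, PNil) (Br C l r, u1, u2),
        ~~ occ [set a] (Br C l r) & ~~ occ [set b] (Br C u1 u2)].
    move=> su au ou; have [_ _ suc sut] := su.
    have [||||C [l [r [x1 [x2 [sx nx ny]]]]]] := @nav_sep _ [set a] [set b] u1 u2 u3 _ _ _ _ ou.
    - by rewrite -suc.
    - by rewrite -suc.
    - by rewrite -sut.
    - exact: au.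
    - exists C, l, r, x1, x2; split=> //.
      exact: same_trans (same_trans sv su) sx.
  case/or3P; first by apply: step ata; apply: same_refl.
    apply: (step t2 t3 t1); first exact: same_rot.
    by move: ata; rewrite /= orbC -orbA.
  apply: (step t3 t1 t2).
    exact: same_trans (same_rot _ _ _) (same_rot _ _ _).
  by move: ata; rewrite /= orbA orbC.
move=> {t1 t2 t3 sv ata sw so sc st ntab ca cb}.
have [wv cv ev] := rep3_root rt sv'; have [_ _ sc st] := sv'.
have cZ3 : conn3 Z (Br C l r, u1, u2) by rewrite -sc conn3_root.
(* [Z] touches [a] on one side of the edge and [b] on the other; being connected, it must use the
   edge itself. *)
have mC : meets C Z.
  have [//|nC] := boolP (meets C Z); exfalso.
  have {}taZ : touch3 [set a] Z (Br C l r, u1, u2) by rewrite -st touch3_root.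
  have {}tbZ : touch3 [set b] Z (Br C l r, u1, u2) by rewrite -st touch3_root.
  have oZ2 : occ Z (Br C u1 u2).
    case/or4P: taZ => [/andP[_ /or3P[h|h|h]]|h|h|h] /=.
    + by rewrite h.
    + by rewrite (top_occ h) orbT.
    + by rewrite (top_occ h) !orbT.
    + by rewrite (touch_occl h) in na.
    + by rewrite (touch_occr h) orbT.
    + by rewrite (touch_occr h) !orbT.
  have oZ1 : occ Z (Br C l r).
    case/or4P: tbZ => [/andP[/or3P[h|h|h] _]|h|h|h].
    + by move: nb; rewrite /= h.
    + by move: nb; rewrite /= (top_occ h) orbT.
    + by move: nb; rewrite /= (top_occ h) !orbT.
    + exact: (touch_occr h).
    + by move: nb; rewrite /= (touch_occl h) orbT.
    + by move: nb; rewrite /= (touch_occl h) !orbT.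
  move: cZ3 oZ1 oZ2; rewrite /= (negPf nC) /=.
  by case: (pspecP Z l); case: (pspecP Z r); case: (pspecP Z u1); case: (pspecP Z u2).
have c3 x : x \in W -> touch [set x] Z t ->
    [&& tconn ([set x] :|: Z) (Br C l r), tconn ([set x] :|: Z) u1 &
        tconn ([set x] :|: Z) u2].
  move=> xW tx; apply: conn3_at; last by rewrite /= meetsU mC orbT.
  rewrite -sc conn3_root connU //.
  by have [_ /(_ _ xW)/andP[]] := rt.
exists (Br [set a; b] (tree_map (merge Z a) (Br C u1 u2)) (tree_map (merge Z b) (Br C l r))).
split=> //; last first.
  move=> w wW.
  have out x u : x \in W -> ~~ occ [set w] (tree_map (merge Z x) u).
    move=> xW; elim: u => [|C' l' IHl r' IHr] //=.
    by rewrite !negb_or meets_merge_out // IHl IHr.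
  have := out a (Br C u1 u2) aW; have := out b (Br C l r) bW.
  rewrite /= !negb_or => -> ->; rewrite !andbT meets1 !inE negb_or.
  by rewrite !(contraNneq _ wW) // => ->.
split.
- have mw x u : wide 2 u -> wide 2 (tree_map (merge Z x) u).
    by apply: wide_map => C'; apply: leq_trans; apply: card_merge.
  move: wv => /and3P[wl wu1 wu2].
  have wu : wide 2 (Br C u1 u2) by rewrite /= wu1 wu2; move: wl => /and3P[->].
  by have := mw a _ wu; have := mw b _ wl; rewrite /= card_ab => -> ->.
- move=> w wW; have /andP[ow cw] := cv _ wW.
  have [wa|wa] := eqVneq w a; [|have [wb|wb] := eqVneq w b].
  + subst w; rewrite occE connE meets1 set21.
    rewrite (tconn_map (fun C => meets_merge Z C aW)).
    rewrite (tconn_map (fun C => meets_merge_other Z C aW neq_ab)).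
    rewrite (nocc_tconn na) andbT.
    by have /and3P[_ h1 h2] := c3 _ aW taZ; rewrite /= meetsU mC orbT h1 h2.
  + subst w; rewrite occE connE meets1 set22.
    rewrite (tconn_map (fun C => meets_merge Z C bW)).
    rewrite (tconn_map (fun C => meets_merge_other Z C bW wa)).
    rewrite (nocc_tconn nb).
    by have /and3P[-> h1 h2] := c3 _ bW tbZ.
  + rewrite occE connE meets1 in_set2 (negPf wa) (negPf wb).
    have fa C' := meets_merge_other Z C' wW wa.
    have fb C' := meets_merge_other Z C' wW wb.
    rewrite !(occ_map fa) !(occ_map fb) !(conn_map fa) !(conn_map fb).
    rewrite (tconn_map fa) (tconn_map fb).
    move: ow cw; rewrite /=; case: (meets C [set w]) => //=;
    by case: (pspecP [set w] l); case: (pspecP [set w] r);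
      case: (pspecP [set w] u1); case: (pspecP [set w] u2).
- move=> u w uW wW Euw.
  have : touch [set u] [set w] (Br C u1 u2) || touch [set u] [set w] (Br C l r).
    apply/orP; case/or4P: (ev _ _ uW wW Euw) => h; [left|right|left|left] => //;
      by apply/or3P; first [exact: Or31 | exact: Or32 | exact: Or33].
  by case/orP=> h; rewrite touchE (touch_merge _ _ _ _ h) ?orbT.
Qed.
End TwoLabels.

End Rep.

(** For one label no place has to be freed: an edge whose bag contains [x] is subdivided and the new
    root edge hangs there. *)
Lemma rooted_at (V : finType) k t (W : {set V}) (E : rel V) x :
  0 < k -> rep k t W E -> x \in W -> rooted k [set x] W E.
Proof.
move=> k0 rt xW; have [_ cW _] := rt; have /andP[ox _] := cW _ xW.
have [[[t1 t2] t3] sv atx] := nav_at PNil PNil ox.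
have [C [l [r [u1 [u2 [sv' xC]]]]]] : exists C l r u1 u2,
    same (t, PNil, PNil) (Br C l r, u1, u2) /\ x \in C.
  have wit u1 u2 u3 : same (t1, t2, t3) (u1, u2, u3) -> meets (top u1) [set x] ->
      exists C l r u1 u2, same (t, PNil, PNil) (Br C l r, u1, u2) /\ x \in C.
    case: u1 => [|C l r] su; first by rewrite meets0.
    rewrite meets1 => xC; exists C, l, r, u2, u3; split=> //.
    exact: same_trans sv su.
  have rot2 : same (t1, t2, t3) (t3, t1, t2).
    exact: same_trans (same_rot _ _ _) (same_rot _ _ _).
  case/or3P: atx; first by apply: (wit _ t2 t3); apply: same_refl.
    by apply: (wit _ t3 t1); apply: same_rot.
  exact: wit rot2.
have [wv cv ev] := rep3_root rt sv'.
exists (Br [set x] (restrict W (Br C u1 u2)) (restrict W (Br C l r))).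
split=> //; last first.
  move=> w wW; have wx : w != x by apply: contraNneq wW => ->.
  by rewrite occE !negb_or !nocc_restrict // !meets1 !inE wx (negPf wW) !andbF.
split.
- case/and3P: wv => wl wu1 wu2.
  have wu : wide k (Br C u1 u2) by rewrite /= wu1 wu2; move: wl => /and3P[->].
  by have := wide_restrict W wl; have := wide_restrict W wu; rewrite /= cards1 k0 => -> ->.
- move=> w wW; have /andP[ow cw] := cv _ wW.
  have f C' := meetsI1 C' wW.
  rewrite occE connE meets1 inE !(occ_map f) !(tconn_map f) !(conn_map f).
  have [wx|wx] := eqVneq w x.
    subst w; have mC : meets C [set x] by rewrite meets1.
    have := conn3_at cw; rewrite /at3 /= mC => /(_ isT).
    by case/and3P => -> -> ->.
  move: ow cw; rewrite /=; case: (meets C [set w]) => //=;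
  by case: (pspecP [set w] l); case: (pspecP [set w] r);
     case: (pspecP [set w] u1); case: (pspecP [set w] u2).
- move=> u w uW wW Euw.
  have : touch [set u] [set w] (Br C u1 u2) || touch [set u] [set w] (Br C l r).
    apply/orP; case/or4P: (ev _ _ uW wW Euw) => h; [left|right|left|left] => //;
      by apply/or3P; first [exact: Or31 | exact: Or32 | exact: Or33].
  by case/orP=> h; rewrite touchE (touch_restrict _ _ h) ?orbT.
Qed.

(* [S] is the leaf set of a rooted binary tree such that the set of leaves below
   each of its nodes satisfies [P]. *)
Inductive btd (V : finType) (P : {set V} -> Prop) : {set V} -> Prop :=
| btd1 u : P [set u] -> btd P [set u]
| btdU S1 S2 : btd P S1 -> btd P S2 -> [disjoint S1 & S2] ->
    P (S1 :|: S2) -> btd P (S1 :|: S2).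

(** * From representations to leaf trees with small cut covers *)

Section Cover.
Variable G : sgraph.
Implicit Types (S T C X Y Z : {set G}).

Definition cutcover S C :=
  forall u w, adj u w -> u \in S -> w \notin S -> (u \in C) || (w \in C).

Definition covered k S := exists2 C : {set G}, #|C| <= k & cutcover S C.

Section RepToBtd.
Variable k : nat.

(** The root bag covers the cut: a vertex of the set outside that bag shares a node of [t] with each
    neighbour, so a neighbour outside the set occurs in [t] and hence belongs to the bag. The
    freedom in [X] lets the parent decide which vertices of the bag become leaves here and which
    become leaves higher up. *)
Lemma rep_btd_sub t X : wide k t -> (forall u, conn [set u] t) ->
  (forall u w, adj u w -> occ [set u] t -> u \notin top t -> touch [set u] [set w] t) ->
  X \subset top t ->
  let S := [set u | occ [set u] t & u \notin top t] :|: X in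
  S != set0 -> btd (covered k) S.
Proof.
elim: t X => [|C l IHl r IHr] X wt ct et /=.
  rewrite subset0 => /eqP->; rewrite setU0 => /set0Pn[u]; by rewrite inE.
case/and3P: (wt) => wC wl wr.
pose S0 := [set u | occ [set u] (Br C l r) & u \notin C].
rewrite -[[set u | _ & u \notin C]]/S0.
have cov Y : Y \subset C -> covered k (S0 :|: Y).
  move=> YC; exists C => // u w Euw; rewrite !inE negb_or => uS /andP[wS wY].
  have [//|uC] := boolP (u \in C).
  case/orP: uS => [/andP[ou _]|/(subsetP YC) h]; last by rewrite h in uC.
  have := touch_occr (et _ _ Euw ou uC); move: wS; rewrite negb_and negbK.
  by case/orP => [/negPf->|].
have cl u : conn [set u] l && conn [set u] r.
  have := ct u; rewrite connE; case: ifP => _; last first.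
    by case: (pspecP [set u] l); case: (pspecP [set u] r).
  by case/andP => /tconn_conn-> /tconn_conn->.
have fact u : [&& occ [set u] l ==> (u \in top l) || (u \notin C) && ~~ occ [set u] r
  & occ [set u] r ==> (u \in top r) || (u \notin C) && ~~ occ [set u] l].
  have := ct u; rewrite connE -!meets1; case: (meets C _) => /=;
  by case: (pspecP [set u] l); case: (pspecP [set u] r).
have el u w : adj u w -> occ [set u] l -> u \notin top l -> touch [set u] [set w] l.
  move=> Euw ou nu; have /andP[] := fact u; rewrite ou (negPf nu) /= => /andP[uC nr] _.
  have := et _ _ Euw _ uC; rewrite /= ou orbT => /(_ isT).
  case/or3P => [/andP[/or3P[]]|//|/touch_occl h].
  - by rewrite meets1 (negPf uC).
  - by rewrite meets1 (negPf nu).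
  - by move/top_occ=> h; rewrite h in nr.
  - by rewrite h in nr.
have er u w : adj u w -> occ [set u] r -> u \notin top r -> touch [set u] [set w] r.
  move=> Euw ou nu; have /andP[_] := fact u; rewrite ou (negPf nu) /= => /andP[uC nl].
  have := et _ _ Euw _ uC; rewrite /= ou !orbT => /(_ isT).
  case/or3P => [/andP[/or3P[]]|/touch_occl h|//].
  - by rewrite meets1 (negPf uC).
  - by move/top_occ=> h; rewrite h in nl.
  - by rewrite meets1 (negPf nu).
  - by rewrite h in nl.
have sub0 : S0 != set0 -> btd (covered k) S0.
  pose S1 := [set u | occ [set u] l & u \notin top l] :|: (top l :\: C).
  (* A vertex of both child bags that is not in [C] is placed on the left. *)
  pose S2 := [set u | occ [set u] r & u \notin top r] :|: ((top r :\: C) :\: top l).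
  have b1 := IHl _ wl (fun u => proj1 (andP (cl u))) el (subsetDl (top l) C).
  have b2 := IHr _ wr (fun u => proj2 (andP (cl u))) er
     (subset_trans (subsetDl _ (top l)) (subsetDl (top r) C)).
  rewrite -/S1 in b1; rewrite -/S2 in b2.
  have S12 : S0 = S1 :|: S2.
    apply/setP => u; rewrite !inE occE; have := fact u.
    rewrite -!meets1; case: (meets C _) => //=;
    by case: (pspecP [set u] l); case: (pspecP [set u] r).
  have d12 : [disjoint S1 & S2].
    rewrite -setI_eq0; apply/eqP/setP => u; rewrite !inE; have := fact u.
    rewrite -!meets1; case: (meets C _) => //=;
    by case: (pspecP [set u] l); case: (pspecP [set u] r).
  have covS : covered k S0 by have := cov set0 (sub0set _); rewrite setU0.
  rewrite S12 in covS *.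
  have [->|n1] := eqVneq S1 set0; first by rewrite set0U.
  have [->|n2] := eqVneq S2 set0; first by rewrite setU0 => _; apply: b1.
  by move=> _; apply: btdU => //; [apply: b1|apply: b2].
(* The vertices of [X] are split off one at a time as single leaves; what remains is still covered
   by [C]. *)
have [n] := ubnP #|X|; elim: n X => // n IHn X; rewrite ltnS => Xn XC SX.
have [X0|/set0Pn[x xX]] := eqVneq X set0.
  by move: SX; rewrite X0 setU0; apply: sub0.
have xC := subsetP XC _ xX.
have cx : covered k [set x].
  exists [set x] => [|u w _ /set1P-> _]; last by rewrite inE eqxx.
  by rewrite cards1; apply: leq_trans wC; rewrite card_gt0; apply/set0Pn; exists x.
have defS : S0 :|: X = [set x] :|: (S0 :|: X :\ x).
  by rewrite setUCA setD1K.
have [S0X|nS0X] := eqVneq (S0 :|: X :\ x) set0.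
  by rewrite defS S0X setU0; apply: btd1.
rewrite defS; apply: btdU.
- exact: btd1.
- apply: IHn => //; last exact: subset_trans (subsetDl _ _) XC.
  by apply: leq_trans Xn; rewrite [in X in _ < X](cardsD1 x) xX.
- by rewrite disjoints1 !inE xC eqxx !andbF.
- by rewrite -defS; apply: cov.
Qed.

Lemma rep_btd t : rep k t [set: G] (@adj G) -> 0 < #|G| -> btd (covered k) [set: G].
Proof.
case=> wt ct et /card_gt0P[x0 _].
have cw u : occ [set u] t && conn [set u] t by apply: ct.
have := @rep_btd_sub t (top t) wt (fun u => proj2 (andP (cw u))).
have -> : [set u | occ [set u] t & u \notin top t] :|: top t = [set: G].
  by apply/setP => u; rewrite !inE; have /andP[-> _] := cw u; case: (u \in top t).
apply=> //; last by apply/set0Pn; exists x0.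
by move=> u w Euw _ _; apply: et.
Qed.
End RepToBtd.
End Cover.

(** * Uncrossing vertex covers *)

Section Uncross.
Variable G : sgraph.
Implicit Types (S T C X Y Z : {set G}).

Definition nbh Z : {set G} := [set w | [exists z in Z, adj z w]].

Lemma nbhP Z w : reflect (exists2 z, z \in Z & adj z w) (w \in nbh Z).
Proof. by rewrite inE; apply: exists_inP. Qed.

Lemma nbhS Z Z' : Z \subset Z' -> nbh Z \subset nbh Z'.
Proof.
move=> ZZ; apply/subsetP => w /nbhP[z zZ zw]; apply/nbhP.
by exists z => //; apply: (subsetP ZZ).
Qed.

Lemma nbhU Z Z' : nbh (Z :|: Z') = nbh Z :|: nbh Z'.
Proof.
apply/eqP; rewrite eqEsubset subUset !nbhS ?subsetUl ?subsetUr // !andbT.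
apply/subsetP => w /nbhP[z /setUP[]zZ zw]; apply/setUP; [left|right];
  by apply/nbhP; exists z.
Qed.

(* Every vertex cover [C] of the cut of [S] contains [bag S (S :\: C)]. *)
Definition bag S Z := (S :\: Z) :|: (nbh Z :\: S).

Definition opt0 S := [arg min_(Z < set0 | Z \subset S) #|bag S Z|].
(** [opt0] fixes the least bag size and [opt] is a smallest set attaining it. This tie-break is what
    turns the uncrossing inequalities into monotonicity, separation of disjoint sets, and the right
    behaviour at leaves. *)
Definition opt S :=
  [arg min_(Z < opt0 S | (Z \subset S) && (#|bag S Z| <= #|bag S (opt0 S)|)) #|Z|].

Lemma optP S : [/\ opt S \subset S,
  forall Z, Z \subset S -> #|bag S (opt S)| <= #|bag S Z| &
  forall Z, Z \subset S -> #|bag S Z| <= #|bag S (opt S)| -> #|opt S| <= #|Z|].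
Proof.
have [s0 m0] : opt0 S \subset S /\ forall Z, Z \subset S -> #|bag S (opt0 S)| <= #|bag S Z|.
  by rewrite /opt0; case: arg_minnP; rewrite ?sub0set.
rewrite /opt; case: arg_minnP => [|Z /andP[ZS Z0] mZ]; first by rewrite s0 leqnn.
split=> // Z' Z'S.
  by apply: leq_trans Z0 (m0 _ Z'S).
by move=> h; apply: mZ; rewrite Z'S; apply: leq_trans Z0.
Qed.

Lemma leq_card2 (T : finType) (A B C D : {set T}) :
  (forall u, (u \in A) + (u \in B) <= (u \in C) + (u \in D)) ->
  #|A| + #|B| <= #|C| + #|D|.
Proof.
have card_sum (S : {set T}) : #|S| = \sum_u (u \in S).
  by rewrite -sum1_card big_mkcond; apply: eq_bigr => u _; case: (u \in S).
move=> H; rewrite (card_sum A) (card_sum B) (card_sum C) (card_sum D).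
by rewrite -!big_split; apply: leq_sum.
Qed.

(** Submodularity across nested sides, checked one vertex at a time. *)
Lemma bag_submod S S' Z Z' : S \subset S' -> Z \subset S -> Z' \subset S' ->
  #|bag S' (Z :|: Z')| + #|bag S (Z :&: Z')| <= #|bag S' Z'| + #|bag S Z|.
Proof.
move=> SS sZ sZ'; apply: leq_card2 => u.
have := subsetP sZ u; have := subsetP sZ' u; have := subsetP SS u.
have := subsetP (nbhS (subsetIl Z Z')) u; have := subsetP (nbhS (subsetIr Z Z')) u.
rewrite /bag nbhU 4!in_setU 8!in_setD in_setU in_setI in_setU.
move: (u \in S) (u \in S') (u \in Z) (u \in Z') (u \in nbh Z) (u \in nbh Z').
move: (u \in nbh _) => n s s' z z' m m' h1 h2 h3 h4 h5.
by case: s' h3 h4 => h3 h4; case: s h3 h5 => h3 h5; case: z h5 => h5;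
  case: z' h4 => h4; case: n h1 h2; case: m; case: m' => h1 h2 //=;
  first [have:= h1 isT|have:= h2 isT|have:= h3 isT|have:= h4 isT|have:= h5 isT].
Qed.

(** The posimodular counterpart for disjoint sides: each set gives up its vertices adjacent to the
    other set. *)
Lemma bag_posimod S1 S2 Z1 Z2 : [disjoint S1 & S2] -> Z1 \subset S1 -> Z2 \subset S2 ->
  #|bag S1 (Z1 :\: nbh Z2)| + #|bag S2 (Z2 :\: nbh Z1)| <= #|bag S1 Z1| + #|bag S2 Z2|.
Proof.
move=> d12 s1 s2; apply: leq_card2 => u.
have far (X Y : {set G}) : u \in nbh (X :\: nbh Y) -> u \notin Y.
  case/nbhP => z /setDP[zX zY] zu; apply: contra zY => uY.
  by apply/nbhP; exists u; rewrite // adj_sym.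
have d := disjointFr d12 (x := u); have := subsetP s1 u; have := subsetP s2 u.
have := subsetP (nbhS (subsetDl Z1 (nbh Z2))) u; have := far Z1 Z2.
have := subsetP (nbhS (subsetDl Z2 (nbh Z1))) u; have := far Z2 Z1.
rewrite /bag; set N1 := nbh (Z1 :\: _); set N2 := nbh (Z2 :\: _).
rewrite 4!in_setU 10!in_setD; move: d.
move: (u \in S1) (u \in S2) (u \in Z1) (u \in Z2) (u \in nbh Z1) (u \in nbh Z2).
move: (u \in N1) (u \in N2) => n1 n2 a1 a2 z1 z2 m1 m2 h1 h2 h3 h4 h5 h6 h7.
by case: a1 h1 h7 => h1 h7; case: a2 h1 h6 => h1 h6; case: z1 h7 h2 => h7 h2;
  case: z2 h6 h4 => h6 h4; case: n1 h4 h5; case: n2 h2 h3; case: m1; case: m2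
  => h2 h3 h4 h5 //=;
  first [by have:= h1 isT|by have:= h2 isT|by have:= h3 isT|by have:= h4 isT
        |by have:= h5 isT|by have:= h6 isT|by have:= h7 isT].
Qed.

Lemma opt_sub S : opt S \subset S. Proof. by case: (optP S). Qed.

(** The union is no better than [opt S'], so by submodularity the intersection is as good as
    [opt S]; having the smallest size, [opt S] is that intersection. *)
Lemma opt_mono S S' : S \subset S' -> opt S \subset opt S'.
Proof.
move=> SS; have [sZ mZ lZ] := optP S; have [sZ' mZ' _] := optP S'.
set Z := opt S in sZ mZ lZ *; set Z' := opt S' in sZ' mZ' *.
have IS : Z :&: Z' \subset S by apply: subset_trans sZ; apply: subsetIl.
have US : Z :|: Z' \subset S' by rewrite subUset sZ' (subset_trans sZ).
have H := bag_submod SS sZ sZ'.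
have {}H : #|bag S (Z :&: Z')| <= #|bag S Z|.
  rewrite -(leq_add2l #|bag S' Z'|); apply: leq_trans H.
  by rewrite leq_add2r mZ'.
by apply/setIidPl/eqP; rewrite eqEcard subsetIl lZ.
Qed.

(** By posimodularity, dropping from [opt S1] its vertices adjacent to [opt S2] costs nothing;
    minimality of size says that there are none. *)
Lemma opt_disjoint S1 S2 : [disjoint S1 & S2] -> [disjoint opt S1 & nbh (opt S2)].
Proof.
move=> d12; have [s1 m1 l1] := optP S1; have [s2 m2 _] := optP S2.
set Z1 := opt S1 in s1 m1 l1 *; set Z2 := opt S2 in s2 m2 *.
pose Y1 := Z1 :\: nbh Z2; pose Y2 := Z2 :\: nbh Z1.
have Y1S : Y1 \subset S1 by apply: subset_trans s1; apply: subsetDl.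
have Y2S : Y2 \subset S2 by apply: subset_trans s2; apply: subsetDl.
have H := bag_posimod d12 s1 s2; rewrite -/Y1 -/Y2 in H.
have {}H : #|bag S1 Y1| <= #|bag S1 Z1|.
  rewrite -(leq_add2r #|bag S2 Z2|); apply: leq_trans H.
  by rewrite leq_add2l m2.
have /eqP eY : Y1 == Z1 by rewrite eqEcard subsetDl l1.
rewrite -eY -setI_eq0; apply/eqP/setP => u; rewrite in_setI in_setD in_set0.
by case: (u \in nbh Z2); rewrite ?andbF.
Qed.

Lemma card_bag_opt k S : covered k S -> #|bag S (opt S)| <= k.
Proof.
case=> C Ck cC; have [_ mS _] := optP S.
apply: leq_trans (mS (S :\: C) (subsetDl _ _)) (leq_trans _ Ck).
apply: subset_leq_card; rewrite subUset; apply/andP; split.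
  by apply/subsetP => u; rewrite !inE negb_and negbK => /andP[/orP[->|/negPf->]].
apply/subsetP => w /setDP[/nbhP[z /setDP[zS zC] zw] wS].
by have := cC _ _ zw zS wS; rewrite (negPf zC).
Qed.

(** The empty set already gives a bag of size 1, so the tie-break admits a nonempty optimum only if
    its bag is empty, that is, if [x] is isolated. *)
Lemma nbh_opt1 x : opt [set x] != set0 -> nbh (opt [set x]) \subset [set x].
Proof.
have [s1 m1 l1] := optP [set x] => n0.
have o1 : opt [set x] = [set x] by apply/eqP; move: s1; rewrite subset1 (negPf n0) orbF.
have nbh0 : nbh set0 = set0.
  by apply/setP => w; rewrite in_set0; apply/negP => /nbhP[z]; rewrite inE.
have b0 : #|bag [set x] set0| = 1 by rewrite /bag setD0 nbh0 set0D setU0 cards1.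
have : #|bag [set x] (opt [set x])| < 1.
  rewrite ltnNge -b0; apply/negP => /(l1 _ (sub0set _)).
  by rewrite o1 cards1 cards0.
rewrite ltnS leqn0 cards_eq0 /bag setU_eq0 => /andP[_].
by rewrite setD_eq0.
Qed.

(** The edge above a leaf set [S] gets the bag of [opt S]. The vertices of [opt S] are finished:
    their edges, even those leaving [S], are already realised below. A vertex outside [S] is in the
    top bag exactly when it is adjacent to [opt S]; since [opt] is monotone, once it appears it
    stays up to the root. *)
Lemma btd_rep k S : 0 < k -> btd (covered k) S -> exists t,
  [/\ wide k t,
     [/\ {in S, forall u, occ [set u] t && conn [set u] t},
         {in S, forall u, u \notin opt S -> u \in top t},
         forall v, v \notin S -> tconn [set v] t &
         forall v, v \notin S -> (v \in top t) = (v \in nbh (opt S))],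
     {in S &, forall u w, adj u w -> touch [set u] [set w] t} &
     forall u w, u \in opt S -> w \notin S -> adj u w -> touch [set u] [set w] t].
Proof.
move=> k0; elim=> {S} [x _|S1 S2 b1 IH1 b2 IH2 d12 cS].
  have iso u w : u \in opt [set x] -> w \notin [set x] -> adj u w -> False.
    move=> uo wx uw; have n0 : opt [set x] != set0 by apply/set0Pn; exists u.
    case/negP: wx; apply: (subsetP (nbh_opt1 n0)); apply/nbhP; by exists u.
  (* The bag of [opt [set x]] would be empty for an isolated [x]; using [[set x]] makes every vertex
     occur. *)
  exists (Br [set x] PNil PNil); split.
  - by rewrite /= cards1 k0.
  - split.
    + by move=> u /set1P->; rewrite /= meets1 inE eqxx.
    + by move=> u ux _.
    + by move=> v _ /=; rewrite if_same.
    + move=> v vx; rewrite /= (negPf vx); apply/esym/negP => /nbhP[z zo].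
      exact: iso.
  - by move=> u w /set1P-> /set1P->; rewrite adj_irrefl.
  - by move=> u w uo wx /(iso _ _ uo wx).
case: IH1 => t1 [w1 [c1 p1 n1 q1] e1 f1]; case: IH2 => t2 [w2 [c2 p2 n2 q2] e2 f2].
pose S := S1 :|: S2; rewrite -/S in cS *.
have S1S : S1 \subset S := subsetUl _ _; have S2S : S2 \subset S := subsetUr _ _.
have o1 := opt_mono S1S; have o2 := opt_mono S2S.
have oS := opt_sub S.
have inb v : v \notin S -> (v \in bag S (opt S)) = (v \in nbh (opt S)).
  by move=> vS; rewrite /bag in_setU !in_setD vS (negPf vS) andbF.
have inb' v : v \in S -> (v \in bag S (opt S)) = (v \notin opt S).
  by move=> vS; rewrite /bag in_setU !in_setD vS andbT orbF.
have out v : v \notin S -> (v \notin S1) /\ (v \notin S2).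
  by rewrite in_setU negb_or => /andP.
(* If [u] from [T1] also occurs in the other tree, it is adjacent to [opt T2], hence outside
   [opt T1], hence in the top bag of its own tree: its two pieces meet at the new node. *)
have half u T1 T2 r1 r2 : u \in T1 -> u \notin T2 -> u \in S ->
   (opt T1 \subset opt S) -> [disjoint opt T1 & nbh (opt T2)] ->
   {in T1, forall u, occ [set u] r1 && conn [set u] r1} ->
   {in T1, forall u, u \notin opt T1 -> u \in top r1} ->
   tconn [set u] r2 -> ((u \in top r2) = (u \in nbh (opt T2))) ->
   occ [set u] r1 /\ if u \notin opt S then tconn [set u] r1 && tconn [set u] r2 else
    (conn [set u] r1 && ~~ occ [set u] r2) || (tconn [set u] r1 && tconn [set u] r2).
  move=> uT1 uT2 uS oT dT cT pT nT qT; have /andP[ou cu] := cT _ uT1.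
  have tc : u \notin opt T1 -> tconn [set u] r1.
    by move=> uo; apply: conn_top; rewrite ?meets1 ?pT.
  split=> //; case: ifP => [uo|_].
    by rewrite nT tc //; apply: contra uo; apply: (subsetP oT).
  rewrite cu /=; have [o|//] := boolP (occ [set u] r2).
  rewrite nT tc //; have := tconn_occ nT o; rewrite meets1 qT => un.
  by rewrite (disjointFl dT un).
exists (Br (bag S (opt S)) t1 t2); split.
- by rewrite /= w1 w2 card_bag_opt.
- split.
  + move=> u uS; rewrite occE connE meets1 inb' //.
    case/setUP: (uS) => uT.
      have uT' : u \notin S2 by rewrite (disjointFr d12 uT).
      have [ou] := half u S1 S2 t1 t2 uT uT' uS o1 (opt_disjoint d12) c1 p1 (n2 _ uT') (q2 _ uT').
      rewrite ou orbT /=; case: ifP => // _ /orP[->//|->]; by rewrite !orbT.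
    have d21 : [disjoint S2 & S1] by rewrite disjoint_sym.
    have uT' : u \notin S1 by rewrite (disjointFl d12 uT).
    have [ou] := half u S2 S1 t2 t1 uT uT' uS o2 (opt_disjoint d21) c2 p2 (n1 _ uT') (q1 _ uT').
    rewrite ou !orbT /= andbC; case: ifP => // _ /orP[->//|]; rewrite ?orbT //.
    by rewrite andbC => ->; rewrite !orbT.
  + by move=> u uS uo; rewrite /= inb'.
  + move=> v vS; have [v1 v2] := out _ vS; rewrite /= meets1 inb //.
    rewrite n1 // n2 //; case: ifP => // /negP vn; apply/andP; split; apply/negP => o.
      have := tconn_occ (n1 _ v1) o; rewrite meets1 q1 // => h; apply: vn.
      exact: (subsetP (nbhS o1)).
    have := tconn_occ (n2 _ v2) o; rewrite meets1 q2 // => h; apply: vn.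
    exact: (subsetP (nbhS o2)).
  + by move=> v vS; rewrite /= inb.
- have cross u w : u \in S1 -> w \in S2 -> adj u w ->
     touch [set u] [set w] (Br (bag S (opt S)) t1 t2).
    move=> uS wS uw; rewrite touchE.
    have [uo|uo] := boolP (u \in opt S1).
      by rewrite f1 ?orbT // (disjointFl d12 wS).
    have [wo|wo] := boolP (w \in opt S2).
      by rewrite (touchC _ _ t2) f2 ?orbT // ?(disjointFr d12 uS) // adj_sym.
    by rewrite /at_ !meets1 (p1 _ uS uo) (p2 _ wS wo) !orbT.
  move=> u w /setUP[]uS /setUP[]wS uw.
  + by rewrite touchE e1 ?orbT.
  + exact: cross.
  + by rewrite touchC cross // adj_sym.
  + by rewrite touchE e2 ?orbT.
- move=> u w uo wS uw; have [ws1 ws2] := out _ wS.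
  have wt : w \in bag S (opt S) by rewrite inb //; apply/nbhP; exists u.
  rewrite touchE; case/setUP: (subsetP oS _ uo) => uS.
    have [uo1|uo1] := boolP (u \in opt S1); first by rewrite f1 ?orbT.
    by rewrite /at_ !meets1 (p1 _ uS uo1) wt !orbT.
  have [uo1|uo1] := boolP (u \in opt S2); first by rewrite f2 ?orbT.
  by rewrite /at_ !meets1 (p2 _ uS uo1) wt !orbT.
Qed.

Lemma btdT_rep k : 0 < k -> btd (covered k) [set: G] ->
  exists t, rep k t [set: G] (@adj G).
Proof. by move=> k0 /(btd_rep k0)[t [wt [ct _ _ _] et _]]; exists t. Qed.
End Uncross.

(** * König's theorem *)

Section Konig.

Definition bcover (U V : finType) (M : {set U * V}) (X : {set U}) (Y : {set V}) :=
  [forall e in M, (e.1 \in X) || (e.2 \in Y)].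

Definition needs_cover (U V : finType) k (M : {set U * V}) :=
  [forall X : {set U}, forall Y : {set V}, bcover M X Y ==> (k <= #|X| + #|Y|)].

Lemma needs_coverPn (U V : finType) k (M : {set U * V}) : ~~ needs_cover k M ->
  exists X Y, bcover M X Y /\ #|X| + #|Y| < k.
Proof.
case/forallPn => X /forallPn[Y]; rewrite negb_imply -ltnNge => /andP[cM lt].
by exists X, Y.
Qed.

(* Two edges sharing an end [u] cannot both be needed: uncrossing a cover that
   misses only the first edge with one that misses only the second, and adding
   [u] to one of the two results, gives covers with too few vertices. *)
Lemma critical_inj (U V : finType) k (M : {set U * V}) : needs_cover k M ->
  {in M, forall e, ~~ needs_cover k (M :\ e)} -> {in M &, injective fst}.
Proof.
move=> hM cM e f eM fM ef; apply/eqP/negPn/negP => nef.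
have miss g X Y : bcover (M :\ g) X Y -> #|X| + #|Y| < k ->
    (g.1 \notin X) && (g.2 \notin Y).
  move=> cg lt; rewrite -negb_or; apply: contraL lt => gXY; rewrite -leqNgt.
  have /forallP/(_ X)/forallP/(_ Y)/implyP := hM; apply.
  apply/forall_inP => h hM'; have [->//|nh] := eqVneq h g.
  by apply: (forall_inP cg); rewrite !inE nh.
have [X1 [Y1 [c1 l1]]] := needs_coverPn (cM _ eM).
have [X2 [Y2 [c2 l2]]] := needs_coverPn (cM _ fM).
have /andP[e1 e2] := miss _ _ _ c1 l1; have /andP[f1 f2] := miss _ _ _ c2 l2.
have fY1 : f.2 \in Y1.
  have := forall_inP c1 f; rewrite !inE fM andbT eq_sym nef => /(_ isT).
  by rewrite -ef (negPf e1).
have eY2 : e.2 \in Y2.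
  have := forall_inP c2 e; rewrite !inE eM andbT nef => /(_ isT).
  by rewrite ef (negPf f1).
have cov g : g \in M -> g != e -> g != f ->
    ((g.1 \in X1) || (g.2 \in Y1)) && ((g.1 \in X2) || (g.2 \in Y2)).
  move=> gM ge gf; apply/andP; split.
    by apply: (forall_inP c1); rewrite !inE ge.
  by apply: (forall_inP c2); rewrite !inE gf.
have big X Y : bcover M X Y -> k <= #|X| + #|Y|.
  by have /forallP/(_ X)/forallP/(_ Y)/implyP := hM.
have b1 : k <= #|X1 :&: X2| + #|Y1 :|: Y2|.
  apply: big; apply/forall_inP => g gM; rewrite !inE.
  have [->|ge] := eqVneq g e; first by rewrite eY2 !orbT.
  have [->|gf] := eqVneq g f; first by rewrite fY1 !orbT.
  case/andP: (cov _ gM ge gf).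
  by case: (g.1 \in X1) => /= [_|->]; case: (g.1 \in X2) => //= ->; rewrite ?orbT.
have b2 : k <= #|e.1 |: (X1 :|: X2)| + #|Y1 :&: Y2|.
  apply: big; apply/forall_inP => g gM; rewrite !inE.
  have [->|ge] := eqVneq g e; first by rewrite eqxx.
  have [->|gf] := eqVneq g f; first by rewrite ef eqxx.
  case/andP: (cov _ gM ge gf).
  by case: (g.1 \in X1); case: (g.1 \in X2); rewrite ?orbT //= => -> ->; rewrite orbT.
have b3 : k <= (#|X1 :|: X2| + #|Y1 :&: Y2|).+1.
  apply: leq_trans b2 _; rewrite -addSn leq_add2r.
  by rewrite cardsU1 -add1n leq_add2r leq_b1.
have : (k + k) <= (#|X1| + #|Y1| + (#|X2| + #|Y2|)).+1.
  rewrite addnACA -(cardsUI X1 X2) -(cardsUI Y1 Y2).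
  apply: leq_trans (leq_add b1 b3) _; rewrite addnS ltnS addnACA.
  by rewrite (addnC #|_ :&: X2|) [X in _ <= X]addnC addnC leqnn.
apply/negP; rewrite -ltnNge.
have := leq_add l1 l2; rewrite addSn addnS; apply: leq_trans.
by [].
Qed.

(** In an edge set minimal among those that need [k] covering vertices every edge is critical, so
    [critical_inj], applied to it and to its transpose, makes it a matching. Its first ends cover
    it, so it has at least [k] edges. *)
Lemma konig (U V : finType) k (E : {set U * V}) : needs_cover k E ->
  exists2 M : {set U * V}, M \subset E &
    [/\ {in M &, injective fst}, {in M &, injective snd} & k <= #|M|].
Proof.
case/minset_exists => M /minsetP[hM minM] ME; exists M => //.
have crit : {in M, forall e, ~~ needs_cover k (M :\ e)}.
  move=> e eM; apply/negP => /minM /(_ (subsetDl _ _)) /setP/(_ e).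
  by rewrite !inE eqxx eM.
have inj1 := critical_inj hM crit.
split=> //; last first.
  have /forallP/(_ (fst @: M))/forallP/(_ set0)/implyP := hM.
  rewrite cards0 addn0 card_in_imset //; apply.
  by apply/forall_inP => e eM; rewrite imset_f.
pose sw (e : U * V) := (e.2, e.1); pose ws (e : V * U) := (e.2, e.1).
have swS (A : {set U * V}) : needs_cover k (ws @^-1: A) = needs_cover k A.
  have cS X Y : bcover (ws @^-1: A) Y X = bcover A X Y.
    apply/forall_inP/forall_inP => H [x y]; rewrite ?inE => xyA.
      by rewrite orbC; apply: (H (y, x)); rewrite inE.
    by rewrite orbC; apply: (H (y, x)).
  apply/forallP/forallP => H X; apply/forallP => Y; apply/implyP.
    by rewrite -cS addnC; have /forallP/(_ X)/implyP := H Y.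
  by rewrite cS addnC; have /forallP/(_ X)/implyP := H Y.
have inj2 : {in ws @^-1: M &, injective fst}.
  apply: (@critical_inj _ _ k); first by rewrite swS.
  move=> e; rewrite inE => eM.
  have -> : ws @^-1: M :\ e = ws @^-1: (M :\ ws e).
    apply/setP => -[x y]; rewrite !inE; case: e {eM} => x' y' /=.
    by rewrite /ws !xpair_eqE /= (andbC (x == x')).
  by rewrite swS crit.
move=> [x y] [x' y'] xM xM' /= eyy.
have := inj2 (y, x) (y', x'); rewrite !inE => /(_ xM xM' eyy).
by case=> -> ->.
Qed.

End Konig.

(** * Matchings and vertex covers of a cut *)

Section Matching.
Variable G : sgraph.
Implicit Types S C : {set G}.

Lemma cover_matching S C : cutcover S C -> max_crossing_matching S <= #|C|.
Proof.
move=> cC; apply/bigmax_leqP => M /andP[/subsetP MS /trivIsetP tM].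
have [->|/set0Pn[e0 e0M]] := eqVneq M set0; first by rewrite cards0.
have meetC e : e \in M -> exists2 x, x \in e & x \in C.
  move/MS; rewrite inE => /andP[/imsetP[[u w] /= uw ->]].
  rewrite inE in uw; case/andP => /set0Pn[x /setIP[xe xS]] /set0Pn[y /setIP[ye]].
  rewrite inE => yS.
  have : adj x y.
    move: xe ye; rewrite !inE => /orP[]/eqP ex /orP[]/eqP ey; subst x y.
    - by rewrite xS in yS.
    - exact: uw.
    - by rewrite adj_sym.
    - by rewrite xS in yS.
  by case/cC/(_ xS yS)/orP => h; [exists x|exists y].
have [x0 _ _] := meetC _ e0M.
pose f e := odflt x0 [pick x in e :&: C].
have fP e : e \in M -> f e \in e :&: C.
  move=> eM; rewrite /f; case: pickP => [x //|h].
  by have [x xe xC] := meetC _ eM; have := h x; rewrite !inE xe xC.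
rewrite -(@card_in_imset _ _ f).
  by apply/subset_leq_card/subsetP => _ /imsetP[e eM ->]; have /setIP[] := fP _ eM.
move=> e e' eM e'M fe; apply/eqP/negPn/negP => /(tM _ _ eM e'M).
move=> d; have /setIP[fe1 _] := fP _ eM; have /setIP[fe2 _] := fP _ e'M.
by rewrite -fe (disjointFr d fe1) in fe2.
Qed.

(** Orienting the crossing edges out of [S] makes them bipartite; since first ends lie in [S] and
    second ends outside, pairs with distinct first and distinct second ends are disjoint as vertex
    sets. *)
Lemma matching_covered k S : max_crossing_matching S <= k -> covered k S.
Proof.
move=> mk; pose E := [set p : G * G | [&& p.1 \in S, p.2 \notin S & adj p.1 p.2]].
have [hE|] := boolP (needs_cover k.+1 E); last first.
  case/needs_coverPn => X [Y [cE lt]]; exists (X :|: Y).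
    by apply: leq_trans (leq_card_setU _ _) _.
  move=> u w uw uS wS; rewrite !inE.
  have := forall_inP cE (u, w); rewrite !inE /= uS wS uw => /(_ isT).
  by case/orP => ->; rewrite ?orbT.
have [M /subsetP ME [inj1 inj2 kM]] := konig hE.
pose pr (p : G * G) := [set p.1; p.2].
have inS p : p \in M -> [&& p.1 \in S, p.2 \notin S & adj p.1 p.2].
  by move/ME; rewrite inE.
have meet p q x : p \in M -> q \in M -> x \in pr p -> x \in pr q -> p = q.
  move=> pM qM; have /and3P[p1 p2 _] := inS _ pM; have /and3P[q1 q2 _] := inS _ qM.
  rewrite !inE => /orP[]/eqP-> /orP[]/eqP eq.
  - exact: inj1.
  - by rewrite -eq p1 in q2.
  - by rewrite -eq (negPf p2) in q1.
  - exact: inj2.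
have inj : {in M &, injective pr}.
  move=> p q pM qM epq; apply: (meet p q p.1) => //; first by rewrite !inE eqxx.
  by rewrite -epq !inE eqxx.
have : #|pr @: M| <= max_crossing_matching S.
  apply: (@leq_bigmax_cond _ _ (fun M : {set {set G}} => #|M|)); apply/andP; split.
    apply/subsetP => _ /imsetP[p pM ->]; have /and3P[p1 p2 pp] := inS _ pM.
    rewrite inE; apply/and3P; split.
    - by apply/imsetP; exists p; rewrite ?inE.
    - by apply/set0Pn; exists p.1; rewrite !inE eqxx.
    - by apply/set0Pn; exists p.2; rewrite !inE eqxx orbT.
  apply/trivIsetP => _ _ /imsetP[p pM ->] /imsetP[q qM ->] npq.
  rewrite -setI_eq0; apply: contraNT npq => /set0Pn[x /setIP[xp xq]].
  by rewrite (meet _ _ _ pM qM xp xq).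
rewrite card_in_imset // => h.
by have := leq_trans kM (leq_trans h mk); rewrite ltnn.
Qed.

Lemma coveredP k S : covered k S <-> max_crossing_matching S <= k.
Proof.
split; last exact: matching_covered.
by case=> C Ck /cover_matching h; apply: leq_trans h Ck.
Qed.

End Matching.

(** * Branch-decompositions *)

Section TreeSides.
Variable T : sgraph.
Hypothesis treeT : is_tree T.
Implicit Types s t p q x y z : T.

Definition tside s t : {set T} := [set z | connect (@adj (del_edge s t)) s z].

Lemma del_edge_connect_sym s t : connect_sym (@adj (del_edge s t)).
Proof. by apply: sym_connect_sym; apply: adj_sym. Qed.

Lemma tsideC s t z : (z \in tside t s) = connect (@adj (del_edge s t)) t z.
Proof.
rewrite inE; apply: (@eq_connect _ _ (@adj (del_edge s t))) => x y.
by rewrite /= /del_edge_adj (setUC [set t]).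
Qed.

Lemma tside_id s t : s \in tside s t. Proof. by rewrite inE connect0. Qed.

(** Otherwise a duplicate-free path from [s] to [t] avoiding the edge closes up with it. The cycle
    has more than two vertices, because a path of length 1 would be the removed edge. *)
Lemma tside_end s t : adj s t -> t \notin tside s t.
Proof.
move=> st; apply/negP; rewrite inE => /connectP[p0 pp0 tE].
case/shortenP: pp0 tE => p /= pp up _ tE.
have [_ _ /(_ (s :: p))] := treeT; apply; last first.
  rewrite /ucycle /= up rcons_path -tE (adj_sym t) st !andbT.
  by apply: sub_path pp => x y /andP[].
case: p pp {up} tE => [_ /= ts|x [|y p]] //=; first by rewrite ts adj_irrefl in st.
by move=> + tx; rewrite -tx /del_edge_adj eqxx andbF.
Qed.

Lemma avoid_edge s p q x y : adj x y -> x != s -> y != s ->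
  [set x; y] != [set p; s] /\ [set x; y] != [set s; q].
Proof.
move=> xy xs ys; split; apply/eqP => /setP/(_ s);
  by rewrite !inE eqxx ?orbT !(eq_sym s) (negPf xs) (negPf ys).
Qed.

Lemma tside_sub s t p : adj s p -> p != t -> tside p s \subset tside s t.
Proof.
move=> sp pt; apply/subsetP => z; rewrite [z \in tside p s]inE => /connectP[r].
have psn : s \notin tside p s by apply: tside_end; rewrite adj_sym.
have pK : p \in tside p s by apply: tside_id.
have pK' : p \in tside s t.
  rewrite inE connect1 //= /del_edge_adj sp /=; apply/eqP => /setP/(_ p).
  rewrite !inE eqxx orbT (negPf pt) orbF => /esym/eqP ps.
  by rewrite ps adj_irrefl in sp.
move=> pr ->; suff H x : x \in tside p s -> x \in tside s t ->
    path (@adj (del_edge p s)) x r -> last x r \in tside s t by apply: H.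
elim: r {pr} x => [|y r IHr] x //= xK xK' /andP[xy pr].
have yK : y \in tside p s.
  rewrite inE; rewrite inE in xK; exact: connect_trans xK (connect1 xy).
apply: IHr => //; rewrite inE; rewrite inE in xK'.
apply: connect_trans xK' (connect1 _); rewrite /= /del_edge_adj.
case/andP: xy => xy _; rewrite xy /=.
have xs : x != s by apply: contraTneq xK => ->.
have ys : y != s by apply: contraTneq yK => ->.
by have [] := @avoid_edge s p t x y xy xs ys.
Qed.

Lemma tside_step s t z : z \in tside s t -> z != s ->
  exists p, [/\ adj s p, p != t & z \in tside p s].
Proof.
rewrite inE => /connectP[p0 pp0 zE].
case/shortenP: pp0 zE => -[|p r] /= pp up _ -> ; first by rewrite eqxx.
move=> _; case/andP: pp => /andP[sp spt] pr; exists p; split=> //.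
  by apply: contraNneq spt => ->.
rewrite inE; apply/connectP; exists r => //.
case/andP: up => sr _.
suff H x (q : seq T) : s \notin x :: q -> path (@adj (del_edge s t)) x q ->
    path (@adj (@del_edge T p s)) x q by exact: (H p r sr pr).
elim: q x => [|y q IHq] x //=; rewrite !inE !negb_or => /and3P[sx sy sq].
case/andP => /andP[xy _] pq; rewrite IHq ?inE ?negb_or ?sy // andbT.
rewrite /del_edge_adj xy /=.
by have [] // := @avoid_edge s p t x y xy; rewrite eq_sym.
Qed.

Lemma tside_disjoint s p q : adj s p -> adj s q -> p != q ->
  [disjoint tside p s & tside q s].
Proof.
move=> sp sq pq; rewrite -setI_eq0; apply/eqP/setP => z; rewrite in_set0.
apply/negP => /setIP[zp]; rewrite tsideC => zq.
have := subsetP (tside_sub sp pq) _ zp; rewrite inE => sz.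
have /negP := tside_end sq; apply; rewrite inE; apply: connect_trans sz _.
by rewrite del_edge_connect_sym.
Qed.

Lemma tside_compl s t : adj s t -> tside t s = ~: tside s t.
Proof.
move=> st; apply/setP => z; rewrite in_setC tsideC [z \in tside s t]inE.
apply/idP/idP => [tz|]; last first.
  have [_ cT _] := treeT; have /connectP[r] := cT s z.
  move=> + -> {z}.
  suff H x : connect (@adj (del_edge s t)) s x || connect (@adj (del_edge s t)) t x ->
     path (@adj T) x r -> ~~ connect (@adj (del_edge s t)) s (last x r) ->
     connect (@adj (del_edge s t)) t (last x r).
    by apply: H; rewrite connect0.
  elim: r x => [|y r IHr] x /=; first by case/orP => ->.
  move=> xst /andP[xy pr]; apply: IHr => //.
  have [/eqP exy|nxy] := boolP ([set x; y] == [set s; t]).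
    have : y \in [set s; t] by rewrite -exy !inE eqxx orbT.
    by case/set2P => ->; rewrite connect0 ?orbT.
  have xy' : @adj (del_edge s t) x y by rewrite /= /del_edge_adj xy.
  by case/orP: xst => /connect_trans h; rewrite (h _ (connect1 xy')) ?orbT.
apply/negP => sz; have /negP := tside_end st; apply; rewrite inE.
by apply: connect_trans sz _; rewrite del_edge_connect_sym.
Qed.

End TreeSides.

(** * From branch-decompositions to leaf trees *)

Section FromDecomp.
Variables (G : sgraph) (D : branch_decomp G).
Notation T := (bd_tree D).
Let treeT : is_tree T := bd_treeP D.

Lemma bd_sideE (s t : T) :
  bd_side s t = [set bd_map l | l : leaf T & val l \in tside s t].
Proof. by apply/setP => u; apply/imsetP/imsetP => -[l]; rewrite !inE; exists l; rewrite ?inE. Qed.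

Lemma mem_bd_side (s t : T) l : (bd_map l \in bd_side s t) = (val l \in tside s t).
Proof.
rewrite bd_sideE; apply/imsetP/idP => [[l']|ls]; last by exists l; rewrite // inE.
by rewrite inE => l's /(bij_inj (bd_bij D)) ->.
Qed.

Lemma bd_side_compl (s t : T) : adj s t -> bd_side t s = ~: bd_side s t.
Proof.
move=> st; apply/setP => u; have [g _ gK] := bd_bij D.
by rewrite -(gK u) inE !mem_bd_side tside_compl // inE.
Qed.

(** Induction on the size of the side: when [s] has degree 3 it carries no label, and the side
    splits into those of its two other neighbours. *)
Lemma decomp_btd_side P : (forall s t : T, adj s t -> P (bd_side s t)) ->
  forall s t : T, adj s t -> btd P (bd_side s t).
Proof.
move=> Ps s t; have [n] := ubnP #|tside s t|; elim: n s t => // n IHn s t.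
rewrite ltnS => le_n st; have tN : t \in [set y | adj s y] by rewrite inE.
have Pst := Ps _ _ st.
have [d1|d3] := bd_degree s.
  have l1 : degree s == 1 by rewrite d1.
  pose l : leaf T := Sub s l1.
  have side1 : bd_side s t = [set bd_map l].
    apply/setP => u; have [g _ gK] := bd_bij D; rewrite -(gK u) mem_bd_side !inE.
    rewrite (inj_eq (bij_inj (bd_bij D))) -val_eqE /=.
    apply/idP/eqP => [|->]; last exact: connect0.
    move=> c; apply/eqP/negPn/negP => zs.
    have c' : val (g u) \in tside s t by rewrite inE.
    have [p [sp pt _]] := tside_step c' zs.
    have := cardsD1 t [set y | adj s y]; rewrite -/(degree s) d1 tN => -[/esym/eqP].
    by rewrite cards_eq0 => /eqP/setP/(_ p); rewrite !inE pt sp.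
  by rewrite side1 in Pst *; apply: btd1.
have := cardsD1 t [set y | adj s y]; rewrite -/(degree s) d3 tN add1n => -[/esym/eqP].
case/cards2P => p [q [pq defN]].
have inN x : ((x != t) && adj s x) = (x == p) || (x == q).
  by move/setP/(_ x): defN; rewrite !inE.
have /andP[pt sp] : (p != t) && adj s p by rewrite inN eqxx.
have /andP[qt sq] : (q != t) && adj s q by rewrite inN eqxx orbT.
have ps : adj p s by rewrite adj_sym.
have qs : adj q s by rewrite adj_sym.
have lt x : adj s x -> x != t -> #|tside x s| < n.
  move=> sx xt; apply: leq_trans le_n; apply: proper_card.
  rewrite properE tside_sub //=; apply/subsetPn; exists s; first exact: tside_id.
  by apply: tside_end => //; rewrite adj_sym.
have defS : bd_side s t = bd_side p s :|: bd_side q s.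
  apply/setP => u; have [g _ gK] := bd_bij D; rewrite -(gK u) in_setU !mem_bd_side.
  apply/idP/orP => [zs|[]]; last first.
  - exact/subsetP/tside_sub.
  - exact/subsetP/tside_sub.
  have ns : val (g u) != s.
    by apply: contraTneq (valP (g u)) => ->; rewrite d3.
  have [x [sx xt xz]] := tside_step zs ns.
  by have := inN x; rewrite xt sx => /esym/orP[]/eqP<-; [left|right].
rewrite defS in Pst *; apply: btdU => //.
- by apply: IHn => //; apply: lt.
- by apply: IHn => //; apply: lt.
rewrite -setI_eq0; apply/eqP/setP => u; have [g _ gK] := bd_bij D.
rewrite -(gK u) in_set0 in_setI !mem_bd_side.
have [h|//] := boolP (_ \in tside p s).
by rewrite (disjointFr (tside_disjoint treeT sp sq pq)).
Qed.

Lemma decomp_btd P : (forall s t : T, adj s t -> P (bd_side s t)) ->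
  P [set: G] -> btd P [set: G].
Proof.
move=> Ps PT; have [/card_gt0P[s _] _ _] := treeT.
have /card_gt0P[t] : 0 < #|[set y | adj s y]|.
  by rewrite -/(degree s); case: (bd_degree s) => ->.
rewrite inE => st.
have defT : [set: G] = bd_side s t :|: bd_side t s.
  by rewrite (bd_side_compl st) setUCr.
rewrite defT in PT *; apply: btdU => //.
- exact: decomp_btd_side.
- by apply: decomp_btd_side => //; rewrite adj_sym.
- by rewrite (bd_side_compl st) -setI_eq0 setICr.
Qed.

End FromDecomp.

(** The root of a binary tree has degree 2, which a branch-decomposition forbids; hanging the tree
    of all other leaves from the leaf [u] repairs this. Descending towards [u], the complement of a
    child is its sibling together with the complement of the parent. The alternatives with equality
    arise because leaf sets are never empty. *)
Lemma btd_reroot (V : finType) (P : {set V} -> Prop) S u :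
  (forall S, P S -> P (~: S)) -> btd P S -> u \in S ->
  (S = [set: V] \/ btd P (~: S)) -> ([set~ u] = set0 \/ btd P [set~ u]).
Proof.
move=> PC; elim=> [x _ /set1P-> [xT|]|S1 S2 b1 IH1 b2 IH2 d12 PS uS cS]; last 2 first.
- by right.
- have Pc (X : {set V}) : btd P X -> P X by case.
  have half X Y : btd P X -> btd P Y -> [disjoint X & Y] -> S1 :|: S2 = X :|: Y ->
      ~: X = [set: V] \/ btd P (~: X).
    move=> bX bY dXY defS; right; case: cS => [sT|bS].
      have -> : ~: X = Y.
        apply/setP => z; have := in_setT z; rewrite -sT defS !inE.
        have [zX|] := boolP (z \in X); first by rewrite (disjointFr dXY zX).
        by move=> _ /= ->.
      exact: bY.
    have defX : ~: X = Y :|: ~: (S1 :|: S2).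
      apply/setP => z; rewrite defS !inE; have [zX|nX] := boolP (z \in X).
        by rewrite (disjointFr dXY zX).
      by case: (z \in Y).
    rewrite defX; apply: btdU => //; last by rewrite -defX; apply/PC/Pc.
    rewrite defS -setI_eq0; apply/eqP/setP => z; rewrite !inE.
    by case: (z \in Y); rewrite ?orbT.
  case/setUP: uS => uS.
    have [h|h] := half S1 S2 b1 b2 d12 erefl; last by apply: IH1 => //; right.
    by move/setP/(_ u): h; rewrite !inE uS.
  have d21 : [disjoint S2 & S1] by rewrite disjoint_sym.
  have [h|h] := half S2 S1 b2 b1 d21 (setUC _ _); last by apply: IH2 => //; right.
  by move/setP/(_ u): h; rewrite !inE uS.
- by left; rewrite xT setCT.
Qed.

(** * Laminar families of leaf sets *)

Record laminar_tree (V : finType) (P : {set V} -> Prop) S (L : {set {set V}}) := {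
  lt_top : S \in L;
  lt_sub X : X \in L -> [/\ X \subset S, X != set0 & P X];
  lt_leaf u : u \in S -> [set u] \in L;
  lt_nest X Y : X \in L -> Y \in L -> [\/ X \subset Y, Y \subset X | [disjoint X & Y]];
  lt_split X : X \in L -> (exists u, X = [set u]) \/
    exists X1 X2, [/\ X1 \in L, X2 \in L, X = X1 :|: X2, [disjoint X1 & X2] &
      forall Y, Y \in L -> Y \proper X -> (Y \subset X1) || (Y \subset X2)] }.

(** Leaf sets of siblings are nonempty and disjoint, so a node is determined by its leaf set. Nodes
    thereby become elements of a finite type, as the vertices of an [sgraph] must be. *)
Lemma btd_laminar (V : finType) (P : {set V} -> Prop) S :
  btd P S -> exists L, laminar_tree P S L.
Proof.
elim=> {S} [u Pu|S1 S2 b1 [L1 l1] b2 [L2 l2] d12 PS].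
  exists [set [set u]]; split.
  - by rewrite inE.
  - by move=> X /set1P->; split=> //; apply/set0Pn; exists u; rewrite inE.
  - by move=> v /set1P->; rewrite inE.
  - by move=> X Y /set1P-> /set1P->; constructor 1.
  - by move=> X /set1P->; left; exists u.
have S1L := lt_top l1; have S2L := lt_top l2.
have [_ n1 _] := lt_sub l1 S1L; have [_ n2 _] := lt_sub l2 S2L.
have s1 X : X \in L1 -> X \subset S1 by case/(lt_sub l1).
have s2 X : X \in L2 -> X \subset S2 by case/(lt_sub l2).
have d X Y : X \in L1 -> Y \in L2 -> [disjoint X & Y].
  by move=> /s1 X1 /s2 Y2; apply: disjointWl X1 (disjointWr Y2 d12).
have L1S X : X \in L1 -> X \subset S1 :|: S2.
  by move/s1 => h; apply: subset_trans h (subsetUl _ _).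
have L2S X : X \in L2 -> X \subset S1 :|: S2.
  by move/s2 => h; apply: subset_trans h (subsetUr _ _).
pose L := (S1 :|: S2) |: (L1 :|: L2).
have LP X : X \in L -> [\/ X = S1 :|: S2, X \in L1 | X \in L2].
  by rewrite !inE => /or3P[/eqP| |] h; [constructor 1|constructor 2|constructor 3].
have nonempty_disj (A B : {set V}) : A != set0 -> [disjoint A & B] -> A \subset B -> False.
  move=> /set0Pn[x xA] dAB /subsetP/(_ x xA) xB.
  by rewrite (disjointFr dAB xA) in xB.
exists L; split.
- by rewrite !inE eqxx.
- move=> X /LP[->|XL|XL].
  + split=> //; apply/set0Pn; have /set0Pn[x xS] := n1; exists x.
    by rewrite inE xS.
  + by split; [apply: L1S|case/(lt_sub l1): XL|case/(lt_sub l1): XL].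
  + by split; [apply: L2S|case/(lt_sub l2): XL|case/(lt_sub l2): XL].
- move=> u /setUP[]uS; rewrite !inE.
    by rewrite (lt_leaf l1) ?orbT.
  by rewrite (lt_leaf l2) ?orbT.
- move=> X Y /LP[->|XL|XL] /LP[->|YL|YL].
  + by constructor 1.
  + by constructor 2; apply: L1S.
  + by constructor 2; apply: L2S.
  + by constructor 1; apply: L1S.
  + exact: (lt_nest l1).
  + by constructor 3; apply: d.
  + by constructor 1; apply: L2S.
  + by constructor 3; rewrite disjoint_sym; apply: d.
  + exact: (lt_nest l2).
- move=> X /LP[->|XL|XL].
  + right; exists S1, S2; split=> //; rewrite ?inE ?S1L ?S2L ?orbT //.
    move=> Y /LP[->|/s1->//|/s2->]; rewrite ?orbT //.
    by rewrite properxx.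
  + have [|[X1 [X2 [X1L X2L defX dX sX]]]] := lt_split l1 XL; first by left.
    right; exists X1, X2; split; rewrite ?inE ?X1L ?X2L ?orbT //.
    move=> Y /LP[->|YL|YL] /[dup] YX /proper_sub sYX; last 2 first.
    * exact: sX.
    * by case: (nonempty_disj Y X) => //; [case/(lt_sub l2): YL|rewrite disjoint_sym d].
    case: (nonempty_disj S2 S1) => //; first by rewrite disjoint_sym.
    by apply: subset_trans (s1 _ XL); apply: subset_trans sYX; apply: subsetUr.
  + have [|[X1 [X2 [X1L X2L defX dX sX]]]] := lt_split l2 XL; first by left.
    right; exists X1, X2; split; rewrite ?inE ?X1L ?X2L ?orbT //.
    move=> Y /LP[->|YL|YL] /[dup] YX /proper_sub sYX; last 2 first.
    * by case: (nonempty_disj Y X) => //; [case/(lt_sub l1): YL|rewrite d].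
    * exact: sX.
    case: (nonempty_disj S1 S2) => //.
    by apply: subset_trans (s2 _ XL); apply: subset_trans sYX; apply: subsetUl.
Qed.

(* The tree of a laminar family on the complement of [u0]: its vertices are the
   members of the family and the full set, which serves as the leaf of [u0];
   its edges are the covering pairs for inclusion. *)
Section LaminarDecomp.
Variables (G : sgraph) (P : {set G} -> Prop) (u0 : G) (L : {set {set G}}).
Hypothesis lt : laminar_tree P [set~ u0] L.
Let L' := [set: G] |: L.

Lemma in_L'P X : X \in L' -> X = [set: G] \/ X \in L.
Proof. by case/setU1P; [left|right]. Qed.

Lemma L_sub X : X \in L -> X \subset [set~ u0]. Proof. by case/(lt_sub lt). Qed.

Lemma L_properT X : X \in L -> X \proper [set: G].
Proof.
move/L_sub=> XS; rewrite properE subsetT /=; apply/subsetPn; exists u0 => //.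
by apply/negP => /(subsetP XS); rewrite !inE eqxx.
Qed.

Lemma T_notin_L : [set: G] \notin L.
Proof. by apply/negP => /L_properT; rewrite properxx. Qed.

Lemma L'_neq0 X : X \in L' -> X != set0.
Proof.
case/in_L'P => [->|/(lt_sub lt)[]//]; by apply/set0Pn; exists u0.
Qed.

Lemma L'_proper (X Y : {set G}) : X \in L' -> X \proper Y -> X \in L.
Proof. by case/in_L'P => [->|//]; rewrite properE subsetT andbF. Qed.

Lemma L'_nest X Y : X \in L' -> Y \in L' ->
  [\/ X \subset Y, Y \subset X | [disjoint X & Y]].
Proof.
case/in_L'P => [->|XL] /in_L'P[->|YL]; rewrite ?subsetT; try by [constructor 1|constructor 2].
exact: (lt_nest lt).
Qed.

Definition covr (X Y : {set G}) :=
  (X \proper Y) && [forall Z in L', ~~ ((X \proper Z) && (Z \proper Y))].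

Lemma covr_proper X Y : covr X Y -> X \proper Y. Proof. by case/andP. Qed.

Lemma covr_between X Y Z : covr X Y -> Z \in L' -> X \proper Z -> Z \proper Y -> False.
Proof. by case/andP => _ /forall_inP H /H + XZ ZY; rewrite XZ ZY. Qed.

Lemma covr_sub X Y Z : covr X Y -> X \in L' -> Y \in L' -> Z \in L' ->
  X \proper Z -> Y \subset Z.
Proof.
move=> cXY XL YL ZL XZ; have [//|ZY|dis] := L'_nest YL ZL.
  have [->//|nZY] := eqVneq Z Y.
  by case: (covr_between cXY ZL XZ); rewrite properEneq nZY.
have /set0Pn[x xX] := L'_neq0 XL.
have xY := subsetP (proper_sub (covr_proper cXY)) _ xX.
by have := subsetP (proper_sub XZ) _ xX; rewrite (disjointFr dis xY).
Qed.

Lemma covr_uniq X Y Y' : covr X Y -> covr X Y' -> X \in L' -> Y \in L' -> Y' \in L' -> Y = Y'.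
Proof.
move=> c c' XL YL YL'; apply/eqP; rewrite eqEsubset.
by rewrite (covr_sub c) ?(covr_sub c') //; apply: covr_proper.
Qed.

Lemma covr_ex X : X \in L -> exists2 Y, Y \in L' & covr X Y.
Proof.
move=> XL; pose Q Y := (Y \in L') && (X \proper Y).
have QT : Q [set: G] by rewrite /Q !inE eqxx L_properT.
case: (arg_minnP (fun Y : {set G} => #|Y|) QT) => Y /andP[YL XY] mY; exists Y => //.
rewrite /covr XY; apply/forall_inP => Z ZL; apply/negP => /andP[XZ ZY].
by have := mY Z; rewrite /Q ZL XZ => /(_ isT); rewrite leqNgt proper_card.
Qed.

Lemma covr_T X : X \in L' -> covr X [set: G] = (X == [set~ u0]).
Proof.
move=> XL; apply/idP/eqP => [cX|->].
  have XL1 : X \in L.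
    exact: L'_proper XL (covr_proper cX).
  apply/eqP; apply: contraT => nX.
  have sT : [set~ u0] \in L' by rewrite inE (lt_top lt) orbT.
  by case: (covr_between cX sT); [rewrite properEneq nX L_sub|apply/L_properT/lt_top/lt].
rewrite /covr (L_properT (lt_top lt)); apply/forall_inP => Z ZL; apply/negP => /andP[h1 h2].
have {}ZL : Z \in L by apply: L'_proper ZL h2.
by move: h1; rewrite properE (L_sub ZL) andbF.
Qed.

Lemma covr_1 X u : X \in L' -> covr X [set u] = false.
Proof.
move=> /L'_neq0 X0; apply/negP => /covr_proper; rewrite properE sub1set => /andP[Xu].
have /set0Pn[x xX] := X0; have := subsetP Xu _ xX; rewrite inE => /eqP xu.
by rewrite -xu xX.
Qed.

Lemma covr_split X : X \in L -> (forall u, X <> [set u]) ->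
  exists X1 X2, [/\ X1 \in L, X2 \in L, X1 != X2 &
    forall Y, Y \in L' -> covr Y X = (Y == X1) || (Y == X2)].
Proof.
move=> XL n1; have [[u /n1]//|[X1 [X2 [X1L X2L defX dX sX]]]] := lt_split lt XL.
have XL' : X \in L' by rewrite inE XL orbT.
have [_ X10 _] := lt_sub lt X1L; have [_ X20 _] := lt_sub lt X2L.
have ndis (A B : {set G}) : A != set0 -> [disjoint A & B] -> A \subset B -> False.
  move=> /set0Pn[x xA] dAB /subsetP/(_ x xA) xB.
  by rewrite (disjointFr dAB xA) in xB.
have dX' : [disjoint X2 & X1] by rewrite disjoint_sym.
have p1 : X1 \proper X.
  rewrite properE defX subsetUl /=; apply/negP; rewrite subUset => /andP[_].
  exact: ndis.
have p2 : X2 \proper X.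
  rewrite properE defX subsetUr /=; apply/negP; rewrite subUset => /andP[+ _].
  exact: ndis.
have L'L Y : Y \in L' -> Y \proper X -> Y \in L.
  by move=> YL; apply: L'_proper.
exists X1, X2; split=> //.
  by apply/eqP => e12; apply: (ndis _ _ X10 dX); rewrite e12.
move=> Y YL; apply/idP/orP => [cY|[]/eqP->].
- have YX := covr_proper cY; have YL1 := L'L _ YL YX.
  have X1L' : X1 \in L' by rewrite inE X1L orbT.
  have X2L' : X2 \in L' by rewrite inE X2L orbT.
  case/orP: (sX _ YL1 YX) => h; [left|right]; apply: contraT => nY.
    by case: (covr_between cY X1L') => //; rewrite properEneq nY.
  by case: (covr_between cY X2L') => //; rewrite properEneq nY.
- rewrite /covr p1; apply/forall_inP => Z ZL; apply/negP => /andP[h1 h2].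
  case/orP: (sX _ (L'L _ ZL h2) h2) => h.
    by move: h1; rewrite properE h andbF.
  by apply: (ndis _ _ X10 dX); apply: subset_trans h; apply: proper_sub.
- rewrite /covr p2; apply/forall_inP => Z ZL; apply/negP => /andP[h1 h2].
  case/orP: (sX _ (L'L _ ZL h2) h2) => h; last first.
    by move: h1; rewrite properE h andbF.
  by apply: (ndis _ _ X20 dX'); apply: subset_trans h; apply: proper_sub.
Qed.

Definition lam_adj : rel {X : {set G} | X \in L'} :=
  fun x y => covr (val x) (val y) || covr (val y) (val x).
Lemma lam_sym : symmetric lam_adj.
Proof. by move=> x y; rewrite /lam_adj orbC. Qed.
Lemma lam_irrefl : irreflexive lam_adj.
Proof. by move=> x; rewrite /lam_adj /covr properxx. Qed.
Definition lam_graph : sgraph := SGraph lam_sym lam_irrefl.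
Implicit Types x y z s t : lam_graph.

Lemma rootP : [set: G] \in L'. Proof. by rewrite !inE eqxx. Qed.
Definition lroot : lam_graph := Sub [set: G] rootP.

Lemma lam_parent x : x != lroot -> val x \in L /\ exists y, covr (val x) (val y).
Proof.
move=> nx; have xL : val x \in L.
  have [xT|//] := in_L'P (valP x); by case/eqP: nx; apply: val_inj.
split=> //; have [Y YL c] := covr_ex xL; by exists (Sub Y YL).
Qed.

Lemma lam_connected : connected lam_graph.
Proof.
have toroot x : connect (@adj lam_graph) x lroot.
  have [n] := ubnP (#|G| - #|val x|); elim: n x => // n IHn x le_n.
  have [->|nx] := eqVneq x lroot; first exact: connect0.
  have [xL [y cy]] := lam_parent nx.
  have xy : adj x y by rewrite /= /lam_adj cy.
  apply: connect_trans (connect1 xy) (IHn _ _); move: le_n; rewrite !ltnS; apply: leq_trans.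
  apply: ltn_sub2l; last exact/proper_card/covr_proper.
  have := proper_card (L_properT xL); by rewrite cardsT.
move=> x y; apply: connect_trans (toroot x) _.
by rewrite (sym_connect_sym lam_sym).
Qed.

Lemma lam_tree : is_tree lam_graph.
Proof.
split; [by apply/card_gt0P; exists lroot|exact: lam_connected|].
move=> c c2; case: c c2 => // x0 c0; set c := x0 :: c0 => c2.
have x0c : x0 \in c by rewrite inE eqxx.
(* A member of least size on a cycle is covered by both of its neighbours there, whereas laminarity
   allows only one cover. *)
case: (arg_minnP (fun x : lam_graph => #|val x|) x0c) => x xc mx.
move=> cyc; case: (rot_to xc) => i p defc.
have : ucycle (@adj lam_graph) (x :: p) by rewrite -defc rot_ucycle.
have memp y : y \in x :: p -> y \in c by rewrite -defc mem_rot.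
have : 2 < size (x :: p) by rewrite -defc size_rot.
case: p {defc} memp => [|y p] memp // szp /andP[/= /andP[xy pyx] /and3P[xp yp up]].
have szp' : 0 < size p by rewrite /= in szp.
rewrite rcons_path in pyx; case/andP: pyx => _ zx.
have up_ z : z \in x :: y :: p -> adj x z -> covr (val x) (val z).
  move=> zc /orP[//|/covr_proper/proper_card].
  by rewrite ltnNge (mx z (memp z zc)).
have zp : last y p \in x :: y :: p by rewrite inE mem_last orbT.
have cz : covr (val x) (val (last y p)) by apply: up_ => //; rewrite adj_sym.
have cy : covr (val x) (val y) by apply: up_ => //; rewrite !inE eqxx orbT.
have eyz : y = last y p by apply: val_inj; apply: covr_uniq cy cz _ _ _; apply: valP.
case: p szp' eyz yp {memp szp xp up zx up_ zp cz} => // z p _ /= eyz.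
by rewrite eyz mem_last.
Qed.

Lemma lam_parent_eq x y0 : covr (val x) (val y0) ->
  forall y, covr (val x) (val y) = (y == y0).
Proof.
move=> c0 y; apply/idP/eqP => [c|->//]; apply: val_inj.
by apply: covr_uniq c c0 _ _ _; apply: valP.
Qed.

Lemma lam_degree_root : degree lroot = 1.
Proof.
have s0P : [set~ u0] \in L' by rewrite inE (lt_top lt) orbT.
rewrite /degree (_ : [set y | _] = [set Sub [set~ u0] s0P :> lam_graph]) ?cards1 //.
apply/setP => y; rewrite !inE /= /lam_adj /= (covr_T (valP y)).
by rewrite {1}/covr properE subsetT andbF.
Qed.

Lemma lam_degree1 x u : x != lroot -> val x = [set u] -> degree x = 1.
Proof.
move=> nx xu; have [_ [y0 c0]] := lam_parent nx.
rewrite /degree (_ : [set y | _] = [set y0]) ?cards1 //.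
apply/setP => y; rewrite !inE /= /lam_adj (lam_parent_eq c0) xu covr_1 ?orbF //.
exact: valP.
Qed.

Lemma lam_degree3 x : x != lroot -> (forall u, val x <> [set u]) -> degree x = 3.
Proof.
move=> nx n1; have [xL [y0 c0]] := lam_parent nx.
have [X1 [X2 [X1L X2L X12 cX]]] := covr_split xL n1.
have X1P : X1 \in L' by rewrite inE X1L orbT.
have X2P : X2 \in L' by rewrite inE X2L orbT.
pose x1 : lam_graph := Sub X1 X1P; pose x2 : lam_graph := Sub X2 X2P.
have x12 : x1 != x2 by rewrite -val_eqE.
have N z : covr (val z) (val x) -> y0 != z.
  move=> cz; apply/eqP => y0z; have := proper_trans (covr_proper cz) (covr_proper c0).
  by rewrite y0z properxx.
rewrite /degree (_ : [set y | _] = [set y0; x1; x2]).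
  have y1 : y0 != x1 by apply: N; rewrite (cX _ X1P) eqxx.
  have y2 : y0 != x2 by apply: N; rewrite (cX _ X2P) eqxx orbT.
  by rewrite setUC cardsU1 cards2 y1 !inE negb_or !(eq_sym x2) y2 x12.
apply/setP => y; rewrite !inE /= /lam_adj (lam_parent_eq c0) (cX _ (valP y)).
by rewrite orbA.
Qed.

Lemma lam_degree x : degree x = 1 \/ degree x = 3.
Proof.
have [->|nx] := eqVneq x lroot; first by left; apply: lam_degree_root.
have [[u xu]|n1] := pselect (exists u, val x = [set u]).
  by left; apply: lam_degree1 xu.
by right; apply: lam_degree3 => // u xu; apply: n1; exists u.
Qed.

(** Only the values at leaves matter; there the set is a singleton or the root, and the choice is
    forced. *)
Definition lam_label x : G := if x == lroot then u0 else odflt u0 [pick u in val x].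

Lemma lam_label1 x u : x != lroot -> val x = [set u] -> lam_label x = u.
Proof.
move=> nx xu; rewrite /lam_label (negPf nx) xu.
by case: pickP => [v /set1P->//|/(_ u)]; rewrite inE eqxx.
Qed.

Lemma lam_leafP (l : leaf lam_graph) :
  (val l = lroot /\ lam_label (val l) = u0) \/
  exists u, [/\ val l != lroot, val (val l) = [set u], u != u0 & lam_label (val l) = u].
Proof.
have [e|nx] := eqVneq (val l) lroot; first by left; rewrite /lam_label e eqxx.
have [[u xu]|n1] := pselect (exists u, val (val l) = [set u]).
  right; exists u; split=> //; last exact: lam_label1.
  have [/L_sub + _] := lam_parent nx; rewrite xu sub1set; by rewrite !inE.
have := valP l; rewrite lam_degree3 // => u xu; by apply: n1; exists u.
Qed.

Lemma lam_label_bij : bijective (fun l : leaf lam_graph => lam_label (val l)).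
Proof.
pose f (l : leaf lam_graph) := lam_label (val l).
have inj : injective f.
  move=> l l'; rewrite /f.
  have [[e ->]|[u [n e nu ->]]] := lam_leafP l;
  have [[e' ->]|[u' [n' e' nu' ->]]] := lam_leafP l'.
  - by move=> _; apply: val_inj; rewrite e e'.
  - by move=> e0; rewrite e0 eqxx in nu'.
  - by move=> e0; rewrite e0 eqxx in nu.
  - by move=> e0; do 2!apply: val_inj; rewrite e e' e0.
have surj u : exists l, f l == u.
  have [->|nu] := eqVneq u u0.
    have d : degree lroot == 1 by rewrite lam_degree_root.
    by exists (Sub lroot d); rewrite /f /= /lam_label eqxx.
  have uL : [set u] \in L by rewrite (lt_leaf lt) // !inE.
  have uP : [set u] \in L' by rewrite inE uL orbT.
  pose x : lam_graph := Sub [set u] uP.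
  have nx : x != lroot.
    by rewrite -val_eqE /=; apply: contraNneq T_notin_L => <-.
  have d : degree x == 1 by rewrite (@lam_degree1 x u).
  by exists (Sub x d); apply/eqP; apply: lam_label1.
exists (fun u => xchoose (surj u)) => [l|u]; last exact/eqP/(xchooseP (surj u)).
by apply: inj; apply/eqP/(xchooseP (surj (f l))).
Qed.

Definition lam_decomp : branch_decomp G :=
  BranchDecomp lam_tree lam_degree lam_label_bij.

(** A walk among the subsets of [s] can leave them only upwards from [s], hence through its unique
    cover [t], and that edge is removed. Conversely every subset climbs to [s] along covers. *)
Lemma lam_tside s t : covr (val s) (val t) ->
  tside s t = [set z : lam_graph | val z \subset val s].
Proof.
move=> cst; have st := covr_proper cst.
have up z y : val z \subset val s -> z != s -> covr (val z) (val y) -> val y \subset val s.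
  move=> zs nz c; apply: (covr_sub c); try exact: valP.
  by rewrite properEneq zs andbT val_eqE.
apply/setP => z; rewrite !inE; apply/idP/idP.
  case/connectP => p + -> {z}.
  suff H x : val x \subset val s -> path (@adj (@del_edge lam_graph s t)) x p ->
    val (last x p) \subset val s by apply: H.
  elim: p x => [|y p IHp] x //= xs /andP[/andP[xy nxy] pp]; apply: IHp => //.
  case/orP: xy => c; last by apply: subset_trans xs; apply/proper_sub/covr_proper.
  have [ex|nx] := eqVneq x s; last exact: up c.
  by move: c nxy; rewrite ex (lam_parent_eq cst) => /eqP->; rewrite eqxx.
have [n] := ubnP (#|val s| - #|val z|); elim: n z => // n IHn z le_n zs.
have [->|nz] := eqVneq z s; first exact: connect0.
have zps : val z \proper val s by rewrite properEneq zs andbT val_eqE.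
have nzr : z != lroot.
  by apply: contraTneq zps => ->; rewrite properE subsetT andbF.
have [_ [y cy]] := lam_parent nzr.
have ys := up _ _ zs nz cy.
rewrite (del_edge_connect_sym (T := lam_graph)).
have nts (u : lam_graph) : val u \subset val s -> t != u.
  by move=> us; apply/eqP => tu; move: st; rewrite tu properE us andbF.
have zy : @adj (@del_edge lam_graph s t) z y.
  rewrite /= /del_edge_adj /= /lam_adj cy /=; apply/eqP => /setP/(_ t).
  by rewrite !inE eqxx orbT (negPf (nts _ zs)) (negPf (nts _ ys)).
apply: connect_trans (connect1 zy) _.
rewrite (del_edge_connect_sym (T := lam_graph)); apply: IHn => //.
move: le_n; rewrite !ltnS; apply: leq_trans; apply: ltn_sub2l.
  exact: proper_card.
exact/proper_card/covr_proper.
Qed.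

Lemma lam_side (s t : bd_tree lam_decomp) : covr (val s) (val t) ->
  bd_side s t = val s.
Proof.
move=> cst; apply/setP => u; have [g _ gK] := lam_label_bij.
rewrite -[u]gK (@mem_bd_side _ lam_decomp s t (g u)) (lam_tside cst) inE.
have sL : val s \in L := L'_proper (valP s) (covr_proper cst).
have [[e ->]|[v [n e nv ->]]] := lam_leafP (g u).
  rewrite e /= subTset; apply/eqP/idP => [sT|u0s].
    by case/negP: T_notin_L; rewrite -sT; exact: sL.
  by have := subsetP (L_sub sL) _ u0s; rewrite !inE eqxx.
by rewrite e sub1set.
Qed.

End LaminarDecomp.

(** * Maximum matching width and representations *)

Section Mmw.
Variable G : sgraph.

Lemma coveredC k (S : {set G}) : covered k S -> covered k (~: S).
Proof.
case=> C Ck cC; exists C => // u w uw; rewrite !inE negbK => uS wS.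
by rewrite orbC; apply: cC => //; rewrite adj_sym.
Qed.

Lemma coveredT k : covered k [set: G].
Proof. by exists set0; rewrite ?cards0 // => u w _ _; rewrite inE. Qed.

Lemma btd_decomp k : 1 < #|G| -> btd (covered k) [set: G] ->
  exists D : branch_decomp G, bd_width D <= k.
Proof.
move=> G2 bT; have /card_gt0P[u0 _] := ltnW G2.
have [|e0|b0] := btd_reroot (@coveredC k) bT (in_setT u0); first by left.
  have := cardsC [set u0]; rewrite e0 cards0 cards1 addn0 => e1.
  by rewrite -e1 in G2.
have [L lt] := btd_laminar b0; exists (lam_decomp lt).
apply/bigmax_leqP => -[s t] /= st.
have PL X : X \in L -> max_crossing_matching X <= k /\ max_crossing_matching (~: X) <= k.
  case/(lt_sub lt) => _ _ cX; split; apply/coveredP => //; exact: coveredC.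
case/orP: (st) => c.
  have sL : val s \in L := L'_proper (valP s) (covr_proper c).
  by rewrite lam_side //; case: (PL _ sL).
have tL : val t \in L := L'_proper (valP t) (covr_proper c).
rewrite (@bd_side_compl _ (lam_decomp lt) t s); last by rewrite adj_sym.
by rewrite lam_side //; case: (PL _ tL).
Qed.

Lemma mmw_le_width (D : branch_decomp G) : mmw G <= bd_width D.
Proof.
rewrite /mmw; case: pselect => // h; case: ex_minnP => m _; apply.
by apply/asboolP; exists D.
Qed.

Lemma rep_mmw k t : 1 < #|G| -> rep k t [set: G] (@adj G) -> mmw G <= k.
Proof.
move=> G2 /rep_btd/(_ (ltnW G2))/(btd_decomp G2)[D wD].
exact: leq_trans (mmw_le_width D) wD.
Qed.

(** Guarantees that some branch-decomposition exists, so that [mmw] is a true minimum and not its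
    default value. *)
Lemma btd_full : 0 < #|G| -> btd (covered #|G|) [set: G].
Proof.
move=> G0; have cov (S : {set G}) : covered #|G| S.
  by exists [set: G]; rewrite ?cardsT // => u w; rewrite inE.
suff H n (S : {set G}) : #|S| <= n.+1 -> S != set0 -> btd (covered #|G|) S.
  by apply: (H #|G|); rewrite -?card_gt0 cardsT // ltnW.
elim: n S => [|n IHn] S Sn S0.
  have /cards1P[x ->] : #|S| == 1 by rewrite eqn_leq Sn card_gt0.
  exact: btd1.
have /set0Pn[x xS] := S0; have defS := setD1K xS.
have [S1|n1] := eqVneq (S :\ x) set0; first by rewrite -defS S1 setU0; apply: btd1.
rewrite -defS; apply: btdU => //; first exact: btd1.
  by apply: IHn => //; move: Sn; rewrite (cardsD1 x) xS ltnS.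
by rewrite disjoints1 !inE eqxx.
Qed.

Lemma mmw_rep k : 0 < k -> mmw G <= k -> exists t, rep k t [set: G] (@adj G).
Proof.
move=> k0; have [G1 _|G2] := leqP #|G| 1.
  (* With at most one vertex the width is 0 by convention, and a single bag suffices because [k] is
     positive. *)
  exists (Br [set: G] PNil PNil); split=> [|w _|u w _ _ _] /=.
  - by rewrite cardsT (leq_trans G1).
  - by rewrite meets1 inE.
  - by rewrite /at_ !meets1 !inE.
have [D0 _] := btd_decomp G2 (btd_full (ltnW G2)).
rewrite /mmw; case: pselect => [h|nh]; last first.
  by case: nh; exists (bd_width D0); apply/asboolP; exists D0.
case: ex_minnP => m /asboolP[D <-] _ wD; apply: btdT_rep => //.
apply: (@decomp_btd _ D); last exact: coveredT.
move=> s t st; apply/coveredP; apply: leq_trans wD.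
exact: (@leq_bigmax_cond _ (fun p : bd_tree D * bd_tree D => adj p.1 p.2)
  (fun p => max_crossing_matching (bd_side p.1 p.2)) (s, t)).
Qed.

End Mmw.

(** * Two-separations *)

Section RepTransfer.
Variables V : finType.
Implicit Types (W X Y U : {set V}) (E : rel V).

Lemma rep_sub k t W W' E E' : rep k t W E -> W' \subset W ->
  {in W' &, forall u w, E' u w -> E u w} -> rep k t W' E'.
Proof.
case=> wt cW eW /subsetP sW EE; split=> //.
- by move=> w /sW; apply: cW.
- by move=> u w uW wW /(EE _ _ uW wW); apply: eW; apply: sW.
Qed.

Lemma rep_image (V' : finType) (f : V' -> V) k t (E' : rel V') E :
  injective f -> (forall u w, E (f u) (f w) -> E' u w) ->
  rep k t [set: V'] E' -> exists t', rep k t' (f @: [set: V']) E.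
Proof.
move=> fI EE [wt cW eW]; exists (tree_map (fun C : {set V'} => f @: C) t).
have m u (C : {set V'}) : meets (f @: C) [set f u] = meets C [set u].
  by rewrite !meets1 mem_imset.
split.
- by apply: wide_map wt => C; rewrite card_imset.
- move=> _ /imsetP[w _ ->]; rewrite (occ_map (m w)) (conn_map (m w)).
  by apply: cW; rewrite inE.
- move=> _ _ /imsetP[u _ ->] /imsetP[w _ ->] /EE Euw.
  by apply: touch_map (eW _ _ _ _ Euw); rewrite ?inE // => C; rewrite m.
Qed.

Lemma touch_set k t W E x y Y : rep k t W E -> x \in W -> y \in W ->
  y \in Y -> E x y -> touch [set x] Y t.
Proof.
case=> _ _ eW xW yW yY Exy; rewrite touchC; apply: (@touchS _ [set y]).
  by rewrite sub1set.
by rewrite touchC; apply: eW.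
Qed.

Lemma touch_set2 k t W E x y X Y : rep k t W E -> x \in W -> y \in W ->
  x \in X -> y \in Y -> E x y -> touch X Y t.
Proof.
move=> rt xW yW xX yY Exy; apply: (@touchS _ [set x]); first by rewrite sub1set.
exact: touch_set rt xW yW yY Exy.
Qed.

Lemma cut_connected1 E x : cut_connected E [set x].
Proof.
move=> U U0; rewrite properE subset1 (negPf U0) orbF => /andP[/eqP->].
by rewrite subxx.
Qed.

Lemma cut_connected_sub E E' X : {in X &, forall u w, E u w -> E' u w} ->
  cut_connected E X -> cut_connected E' X.
Proof.
move=> EE cX U U0 UX; have [u uU [w wU Euw]] := cX U U0 UX.
exists u => //; exists w => //; apply: EE Euw.
  exact: (subsetP (proper_sub UX)).
by case/setDP: wU.
Qed.

Lemma cut_connectedU1 E X u w : symmetric E -> cut_connected E X -> u \in X ->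
  E u w -> cut_connected E (w |: X).
Proof.
move=> sE cX uX Euw U U0 UX.
have [wU|wU] := boolP (w \in U).
  have [UX0|UX0] := eqVneq (U :&: X) set0.
    exists w => //; exists u; last by rewrite sE.
    rewrite !inE uX orbT andbT; apply/negP => uU.
    by move/setP/(_ u): UX0; rewrite !inE uU uX.
  have UXp : U :&: X \proper X.
    rewrite properE subsetIr /=; apply/negP => sX.
    move: UX; rewrite properE subUset sub1set wU /= => /andP[_ /negP]; apply.
    by apply: subset_trans sX (subsetIl _ _).
  have [x /setIP[xU _] [y]] := cX _ UX0 UXp.
  rewrite !inE => /andP[yU yX] Exy; exists x => //; exists y => //.
  by rewrite !inE yX orbT andbT; apply: contra yU => ->.
have UsX : U \subset X.
  apply/subsetP => x xU; have := subsetP (proper_sub UX) _ xU.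
  by rewrite !inE => /orP[/eqP xw|//]; rewrite -xw xU in wU.
have [UX'|nUX] := eqVneq U X.
  exists u; first by rewrite UX'.
  by exists w => //; rewrite !inE eqxx andbT.
have [|x xU [y]] := cX U U0; first by rewrite properEneq nUX.
rewrite !inE => /andP[yU yX] Exy; exists x => //; exists y => //.
by rewrite !inE yX yU orbT.
Qed.

(** Two connected sets grow from [p] and [q]: while they do not exhaust [X], an edge leaves their
    union and its outer end joins one of them. *)
Lemma cut_connected_split E X p q : symmetric E -> cut_connected E X ->
  p \in X -> q \in X -> p != q -> exists Y Z : {set V},
  [/\ p \in Y, q \in Z, [disjoint Y & Z], Y :|: Z = X &
      cut_connected E Y /\ cut_connected E Z].
Proof.
move=> sE cX pX qX pq.
suff grow n (Y Z : {set V}) : #|X :\: (Y :|: Z)| <= n -> p \in Y -> q \in Z ->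
    [disjoint Y & Z] -> Y :|: Z \subset X -> cut_connected E Y ->
    cut_connected E Z -> exists Y Z : {set V}, [/\ p \in Y, q \in Z, [disjoint Y & Z],
      Y :|: Z = X & cut_connected E Y /\ cut_connected E Z].
  apply: (grow #|X| [set p] [set q]); rewrite ?inE //.
  - by rewrite subset_leq_card ?subsetDl.
  - by rewrite disjoints1 inE.
  - by rewrite subUset !sub1set pX.
  - exact: cut_connected1.
  - exact: cut_connected1.
elim: n Y Z => [|n IHn] Y Z.
  rewrite leqn0 cards_eq0 setD_eq0 => sX pY qZ dYZ YZX cY cZ; exists Y, Z; split=> //.
  by apply/eqP; rewrite eqEsubset YZX.
move=> le_n pY qZ dYZ YZX cY cZ.
have [eX|nX] := eqVneq (Y :|: Z) X; first by exists Y, Z.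
have [||u uYZ [w /setDP[wX wYZ] Euw]] := cX (Y :|: Z).
- by apply/set0Pn; exists p; rewrite inE pY.
- by rewrite properEneq nX.
have lt_n (U : {set V}) : U = w |: (Y :|: Z) -> #|X :\: U| <= n.
  move=> ->; rewrite -ltnS; apply: leq_trans le_n; apply: proper_card.
  rewrite properE setDS ?subsetUr //=; apply/subsetPn; exists w.
    by rewrite !inE in wYZ *; rewrite wX wYZ.
  by rewrite !inE eqxx.
have sX (U : {set V}) : U = w |: (Y :|: Z) -> U \subset X.
  by move=> ->; rewrite subUset sub1set wX.
move: (wYZ); rewrite inE negb_or => /andP[wY wZ].
case/setUP: uYZ => uYZ.
- apply: (IHn (w |: Y) Z) => //.
  + by apply: lt_n; rewrite setUA.
  + by rewrite inE pY orbT.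
  + by rewrite disjoints_subset subUset sub1set inE wZ -disjoints_subset.
  + by apply: sX; rewrite setUA.
  + exact: cut_connectedU1 Euw.
- apply: (IHn Y (w |: Z)) => //.
  + by apply: lt_n; rewrite setUCA.
  + by rewrite inE qZ orbT.
  + by rewrite disjoint_sym disjoints_subset subUset sub1set inE wY -disjoints_subset disjoint_sym.
  + by apply: sX; rewrite setUCA.
  + exact: cut_connectedU1 Euw.
Qed.

End RepTransfer.

(** Combines the two ways of creating the edge. If the subtrees of [a] and [b] do not meet, the
    connected union of [X] and [Y] plays the part of the merged set. *)
Lemma rooted_ab (V : finType) t (W0 W : {set V}) (E0 E : rel V) a b (X Y : {set V}) :
  rep 2 t W0 E0 -> W \subset W0 -> X \subset W0 -> Y \subset W0 ->
  {in W &, forall u w, E u w -> E0 u w} -> a \in W -> b \in W -> a != b ->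
  [disjoint X & W] -> [disjoint Y & W] -> [disjoint X & Y] ->
  cut_connected E0 X -> cut_connected E0 Y ->
  (exists2 x, x \in X & E0 a x) -> (exists2 y, y \in Y & E0 b y) ->
  (exists2 x, x \in X & exists2 y, y \in Y & E0 x y) ->
  rooted 2 [set a; b] W E.
Proof.
move=> rt WW XW YW EE aW bW ab dXW dYW dXY cX cY [x xX ax] [y yY by_] [x' x'X [y' y'Y xy]].
have aW0 := subsetP WW _ aW; have bW0 := subsetP WW _ bW.
have inX z : z \in X -> z \in W0 by apply/subsetP.
have inY z : z \in Y -> z \in W0 by apply/subsetP.
have rW : rep 2 t W E := rep_sub rt WW EE.
have taX : touch [set a] X t := touch_set rt aW0 (inX _ xX) xX ax.
have tbY : touch [set b] Y t := touch_set rt bW0 (inY _ yY) yY by_.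
have tXY : touch X Y t := touch_set2 rt (inX _ x'X) (inY _ y'Y) x'X y'Y xy.
have cnX : conn X t by apply: conn_set rt XW _ cX; apply/set0Pn; exists x.
have cnY : conn Y t by apply: conn_set rt YW _ cY; apply/set0Pn; exists y.
have [tab|ntab] := boolP (touch [set a] [set b] t).
  by apply: (rooted_touch rW aW bW ab dXW dYW dXY cnX cnY taX tXY _ tab); rewrite touchC.
apply: (@rooted_apart _ _ _ _ a b rW aW bW ab (X :|: Y)) => //.
- rewrite -setI_eq0 setIUl setU_eq0; move: dXW dYW.
  by rewrite -!setI_eq0 => -> ->.
- exact: connU.
- by rewrite touchC; apply: (@touchS _ X); rewrite ?subsetUl // touchC.
- by rewrite touchC; apply: (@touchS _ Y); rewrite ?subsetUr // touchC.
Qed.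

Lemma iso_path_seq (G : sgraph) (S : {set G}) (s : seq G) x0 : uniq s ->
  S =i s -> (forall i j, i < size s -> j < size s ->
    adj (nth x0 s i) (nth x0 s j) = (i.+1 == j) || (j.+1 == i)) ->
  iso (induced S) (path_graph (size s)).
Proof.
move=> us Ss H.
have lt (x : induced S) : index (val x) s < size s.
  by rewrite index_mem -Ss; apply: valP.
have inS (i : 'I_(size s)) : nth x0 s i \in S by rewrite Ss mem_nth.
exists (fun x : induced S => Ordinal (lt x) : path_graph (size s)); split.
  exists (fun i : path_graph (size s) => Sub (nth x0 s i) (inS i) : induced S).
    by move=> x; apply: val_inj; rewrite /= nth_index // -Ss; apply: valP.
  by move=> i; apply: val_inj; rewrite /= index_uniq.
move=> x y; rewrite /= /path_adj /= -H ?lt //.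
by rewrite /induced_adj !nth_index // -Ss; apply: valP.
Qed.

(** * Separations in a minor-minimal graph *)

Section TwoSeparation.
Variable G : sgraph.

Record separates (a b : G) (A B : {set G}) : Prop := {
  sep_ab : a != b;
  sep_cover x : [|| x == a, x == b, x \in A | x \in B];
  sep_disj : [disjoint A & B];
  sep_notA : (a \notin A) && (b \notin A);
  sep_notB : (a \notin B) && (b \notin B);
  sep_noedge u w : u \in A -> w \in B -> ~~ adj u w;
  sep_connA : cut_connected (@adj G) A;
  sep_connB : cut_connected (@adj G) B;
  sep_aA : exists2 x, x \in A & adj a x;
  sep_bA : exists2 x, x \in A & adj b x;
  sep_aB : exists2 x, x \in B & adj a x;
  sep_bB : exists2 x, x \in B & adj b x }.

Lemma separates_swap a b A B : separates a b A B -> separates a b B A.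
Proof.
case=> ab cv dAB nA nB ne cA cB aA bA aB bB; split=> //.
- by move=> x; move: (cv x); rewrite (orbC (x \in A)).
- by rewrite disjoint_sym.
- by move=> u w uB wA; rewrite adj_sym; apply: ne.
Qed.

Lemma separates_swap_ends a b A B : separates a b A B -> separates b a A B.
Proof.
case=> ab cv dAB nA nB ne cA cB aA bA aB bB; split=> //.
- by rewrite eq_sym.
- by move=> x; move: (cv x); rewrite orbCA.
- by rewrite andbC.
- by rewrite andbC.
Qed.

Hypothesis no_rep : ~ exists t, rep 2 t [set: G] (@adj G).
Hypothesis minor_rep : forall H, minor_step G H ->
  exists t, rep 2 t [set: H] (@adj H).

Lemma del_edge_rep (x y : G) : adj x y ->
  exists t, rep 2 t [set: G] (del_edge_adj x y).
Proof. by move=> xy; apply: (minor_rep (step_del_edge xy)). Qed.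

Lemma del_vert_rep (w : G) : exists t, rep 2 t [set~ w] (@adj G).
Proof.
have [t rt] := minor_rep (step_del_vert w).
have [t' rt'] := @rep_image G _ val 2 t _ (@adj G) val_inj (fun u w h => h) rt.
exists t'; apply: rep_sub rt' _ _ => //; apply/subsetP => x xw.
by apply/imsetP; exists (Sub x xw : del_verts [set w]).
Qed.

(** The adjacency of the contraction, transported to [G] so that the representations of all minors
    live on one type. *)
Definition contract_rel (x y : G) : rel G := fun u v => (u != v) &&
  [|| adj u v, (u == x) && adj y v | (v == x) && adj u y].

Lemma contract_rep (x y : G) : adj x y ->
  exists t, rep 2 t [set~ y] (contract_rel x y).
Proof.
move=> xy; have [t rt] := minor_rep (step_contract xy).
have [t' rt'] := @rep_image G _ val 2 t _ (contract_rel x y) val_inj (fun u w h => h) rt.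
exists t'; apply: rep_sub rt' _ _ => //; apply/subsetP => z; rewrite !inE => zy.
by apply/imsetP; exists (Sub z zy : contract x y).
Qed.

Lemma separates_edge a b A B u w : separates a b A B -> adj u w ->
  let WA := A :|: [set a; b] in let WB := B :|: [set a; b] in
  (u \in WA) && (w \in WA) || (u \in WB) && (w \in WB).
Proof.
move=> sp uw; have uv := sep_cover sp u; have wv := sep_cover sp w.
rewrite /= !inE; move: uv wv.
have := sep_noedge sp (u := u) (w := w); rewrite uw.
have := sep_noedge sp (u := w) (w := u); rewrite adj_sym uw.
by do 8!case: (_ \in _) || case: (_ == _) => //=.
Qed.

Notation side A a b := (A :|: [set a; b]).
Implicit Types (a b : G) (A B X Y : {set G}).

Lemma side_mem a b A B x : separates a b A B -> x \in B -> x \notin side A a b.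
Proof.
move=> sp xB; rewrite !inE (disjointFl (sep_disj sp) xB) /=.
have /andP[aB bB] := sep_notB sp.
by rewrite negb_or; apply/andP; split; [apply: contraNneq aB|apply: contraNneq bB] => <-.
Qed.

Lemma side_disjoint a b A B X : separates a b A B -> X \subset B ->
  [disjoint X & side A a b].
Proof.
move=> sp /subsetP XB; rewrite disjoints_subset; apply/subsetP => x /XB xB.
by rewrite inE; apply: side_mem sp xB.
Qed.

(** The relation [E] may lack an edge between [a] and [b], since the gluing edge carries both; this
    is what makes it apply to the graph without that edge. *)
Lemma glue_false a b A B (E : rel G) : separates a b A B ->
  (forall u w, adj u w -> E u w || (u \in [set a; b]) && (w \in [set a; b])) ->
  rooted 2 [set a; b] (side A a b) E -> rooted 2 [set a; b] (side B a b) E -> False.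
Proof.
move=> sp EE rA rB; apply: no_rep.
have [||||t rt] := rooted_glue _ _ _ _ rA rB.
- by rewrite cards2; case: (a != b).
- exact: subsetUr.
- exact: subsetUr.
- apply/subsetP => x; rewrite !inE => /andP[/orP[xA|//] /orP[xB|//]].
  by rewrite (disjointFr (sep_disj sp) xA) in xB.
exists t; apply: rep_sub rt _ _.
  apply/subsetP => x _; have := sep_cover sp x; rewrite !inE.
  by case/or4P => ->; rewrite ?orbT.
move=> u w _ _ uw; have := separates_edge sp uw => /= ->; rewrite andbT.
exact: EE.
Qed.

Lemma del_edge_adjl (x y u w : G) : u != x -> u != y -> adj u w -> del_edge_adj x y u w.
Proof.
move=> ux uy uw; rewrite /del_edge_adj uw /=; apply/eqP => /setP/(_ u).
by rewrite !inE eqxx (negPf ux) (negPf uy).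
Qed.

Lemma del_edge_adjr (x y u w : G) : w != x -> w != y -> adj u w -> del_edge_adj x y u w.
Proof.
move=> wx wy uw; rewrite del_edge_sym.
by apply: del_edge_adjl; rewrite // adj_sym.
Qed.

Lemma cut_pair_nonadjacent a b A B : separates a b A B -> ~~ adj a b.
Proof.
move=> sp; apply/negP => ab; have [t rt] := del_edge_rep ab.
have orab u w : adj u w -> del_edge_adj a b u w || (u \in [set a; b]) && (w \in [set a; b]).
  move=> uw; rewrite /del_edge_adj uw /=; case: eqP => //= <-.
  by rewrite !inE !eqxx orbT.
(* If [a] and [b] share a node, the representation of the graph without their edge already
   represents [G]. *)
have [tab|ntab] := boolP (touch [set a] [set b] t).
  apply: no_rep; exists t; case: (rt) => wt cW eW; split=> // u w _ _ uw.
  have [duw|nuw] := boolP (del_edge_adj a b u w); first by apply: eW; rewrite ?inE.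
  move: uw (orab _ _ uw); rewrite (negPf nuw) => uw /andP[/set2P[]eu /set2P[]ew];
    subst u w => //; rewrite ?adj_irrefl // in uw.
  by rewrite touchC.
have apart X Y : separates a b X Y -> rooted 2 [set a; b] (side X a b) (del_edge_adj a b).
  move=> sXY; have rX : rep 2 t (side X a b) (del_edge_adj a b).
    by apply: rep_sub rt _ _ => //; apply: subsetT.
  have /andP[aY bY] := sep_notB sXY.
  have nY y : y \in Y -> y != a /\ y != b.
    by move=> yY; split; [apply: contraNneq aY|apply: contraNneq bY] => <-.
  have tY x : (exists2 y, y \in Y & adj x y) -> touch [set x] Y t.
    case=> y yY xy; have [ya yb] := nY _ yY.
    by apply: touch_set rt _ _ yY _; rewrite ?inE // del_edge_adjr.
  apply: (@rooted_apart _ t _ _ a b rX _ _ (sep_ab sXY) Y) => //; rewrite ?inE ?eqxx ?orbT //.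
  - exact: side_disjoint sXY _.
  - apply: conn_set rt _ _ _; rewrite ?subsetT //.
      by have [y yY _] := sep_aB sXY; apply/set0Pn; exists y.
    apply: cut_connected_sub (sep_connB sXY) => u w uY _ uw.
    by have [ua ub] := nY _ uY; apply: del_edge_adjl.
  - exact: tY (sep_aB sXY).
  - exact: tY (sep_bB sXY).
by apply: (glue_false sp orab); [apply: apart sp|apply: apart (separates_swap sp)].
Qed.

(** A cut of [X :\ w] lifts to a cut of [X] by putting [w] on the side of [p]. *)
Lemma cut_connected_contract (E : rel G) X p w :
  (forall u v, adj u v -> E u v) -> (forall v, p != v -> adj w v -> E p v) ->
  (forall u, u != p -> adj u w -> E u p) -> p \in X -> p != w ->
  cut_connected (@adj G) X -> cut_connected E (X :\ w).
Proof.
move=> E1 E2 E3 pX pw cX U U0 UX.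
have UX' := proper_sub UX; have [_ [z]] := properP UX; rewrite !inE => /andP[zw zX] zU.
have UsX : U \subset X by apply: subset_trans UX' (subsetDl _ _).
have nw u : u \in U -> u != w by move/(subsetP UX'); rewrite !inE => /andP[].
have [pU|pU] := boolP (p \in U).
  have [||u uU [v]] := cX (if w \in X then w |: U else U).
  - by case: ifP => // _; apply/set0Pn; exists p; rewrite !inE pU orbT.
  - case: ifP => wX; apply/properP; split.
    + by rewrite subUset sub1set wX.
    + by exists z => //; rewrite !inE negb_or zw.
    + exact: UsX.
    + by exists z.
  move=> vU uv; have {uU} uU : (u == w) || (u \in U).
    by move: uU; case: ifP => _; rewrite ?inE // => ->; rewrite orbT.
  have {vU} [vw vX vU] : [/\ v != w, v \in X & v \notin U].
    move: vU; case: ifP => wX; rewrite !inE ?negb_or.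
      by case/andP => /andP[].
    by case/andP => vU vX; split=> //; apply: contraFneq wX => <-.
  case/orP: uU => [/eqP uw|uU]; last first.
    by exists u => //; exists v; rewrite ?inE ?vw ?vX ?vU //; apply: E1.
  exists p => //; exists v; first by rewrite !inE vw vX vU.
  by apply: E2; rewrite -?uw //; apply: contraNneq vU => <-.
have [|u uU [v]] := cX U U0.
  by apply/properP; split=> //; exists z.
rewrite !inE => /andP[vU vX] uv; exists u => //.
have [vw|vw] := eqVneq v w; last by exists v; rewrite ?inE ?vw ?vX ?vU //; apply: E1.
exists p; first by rewrite !inE pw pX pU.
by apply: E3; rewrite -?vw //; apply: contraNneq pU => <-.
Qed.

(** Since [X] is more than [p], it contains a neighbour [w] of [p]. Contracting [w] into [p] happens
    inside [B]: the side of [A] and the chain a, X, Y, b both survive. *)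
Lemma rooted_contract a b A B X Y p : separates a b A B -> X :|: Y = B ->
  [disjoint X & Y] -> cut_connected (@adj G) X -> cut_connected (@adj G) Y ->
  p \in X -> adj a p -> (exists2 q, q \in Y & adj b q) -> X != [set p] ->
  rooted 2 [set a; b] (side A a b) (@adj G).
Proof.
move=> sp defB dXY cX cY pX ap bY nX.
have [||u /set1P-> [w /setDP[wX wp] pw]] := cX [set p].
- by apply/set0Pn; exists p; rewrite inE.
- by rewrite properEneq eq_sym nX sub1set.
have {}wp : p != w by rewrite inE eq_sym in wp.
have [t rt] := contract_rep pw.
have E1 u' v : adj u' v -> contract_rel p w u' v.
  move=> uv; rewrite /contract_rel uv andbT; apply: contraTneq uv => ->.
  by rewrite adj_irrefl.
have E2 v : p != v -> adj w v -> contract_rel p w p v.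
  by move=> pv wv; rewrite /contract_rel pv eqxx wv orbT.
have E3 v : v != p -> adj v w -> contract_rel p w v p.
  by move=> pv wv; rewrite /contract_rel pv eqxx wv !orbT.
have XB : X \subset B by rewrite -defB subsetUl.
have YB : Y \subset B by rewrite -defB subsetUr.
have wB := subsetP XB _ wX.
have pX' : p \in X :\ w by rewrite !inE wp.
apply: (@rooted_ab _ t [set~ w] _ (contract_rel p w) _ a b (X :\ w) Y) => //.
- apply/subsetP => x; rewrite [x \in [set~ w]]inE inE => xS.
  by apply: contraTneq xS => ->; apply: side_mem sp wB.
- by apply/subsetP => x; rewrite !inE => /andP[].
- apply/subsetP => x xY; rewrite !inE; apply: contraTneq xY => ->.
  by rewrite (disjointFr dXY wX).
- by move=> x y _ _; apply: E1.
- by rewrite !inE eqxx orbT.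
- by rewrite !inE eqxx !orbT.
- exact: sep_ab sp.
- by apply: side_disjoint sp _; apply: subset_trans XB; apply: subsetDl.
- exact: side_disjoint sp YB.
- by apply: disjointWl dXY; apply: subsetDl.
- exact: (cut_connected_contract E1 E2 E3 pX wp cX).
- by apply: cut_connected_sub cY => x y _ _; apply: E1.
- by exists p => //; apply: E1.
- by case: bY => q qY bq; exists q => //; apply: E1.
have cB := sep_connB sp; have [||x xX [y]] := cB X.
- by apply/set0Pn; exists p.
- rewrite properEneq XB andbT; apply/eqP => XB'; case: bY => q qY _.
  by have := subsetP YB _ qY; rewrite -XB' (disjointFl dXY qY).
rewrite inE -defB inE => /andP[/negPf nyX]; rewrite nyX /= => yY xy.
have [xw|xw] := eqVneq x w.
  exists p => //; exists y => //; apply: E2; rewrite -?xw //.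
  by apply: contraFneq nyX => <-.
by exists x; rewrite ?inE ?xw //; exists y => //; apply: E1.
Qed.

(** The chain a, p, q, b survives the deletion of the chord [aq], which is no edge of the side of
    [A]. *)
Lemma rooted_delete a b A p q : separates a b A [set p; q] -> adj p q ->
  adj a p -> adj b q -> adj a q -> rooted 2 [set a; b] (side A a b) (@adj G).
Proof.
move=> sp pq ap bq aq; have [t rt] := del_edge_rep aq.
have := sep_notB sp; rewrite !inE !negb_or => /andP[/andP[nap naq] /andP[nbp nbq]].
have npq : p != q by apply: contraTneq pq => ->; rewrite adj_irrefl.
have nab := sep_ab sp.
have pB : [set p] \subset [set p; q] by rewrite sub1set !inE eqxx.
have qB : [set q] \subset [set p; q] by rewrite sub1set !inE eqxx orbT.
apply: (@rooted_ab _ t [set: G] _ (del_edge_adj a q) _ a b [set p] [set q]);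
  rewrite ?subsetT ?inE ?eqxx ?orbT //.
- move=> u w uS wS uw; rewrite /del_edge_adj uw /=; apply/eqP => /setP/(_ q).
  rewrite !inE eqxx orbT => /orP[]/eqP qu.
    by have := side_mem sp (subsetP qB _ (set11 q)); rewrite qu uS.
  by have := side_mem sp (subsetP qB _ (set11 q)); rewrite qu wS.
- exact: side_disjoint sp pB.
- exact: side_disjoint sp qB.
- by rewrite disjoints1 inE.
- exact: cut_connected1.
- exact: cut_connected1.
- by exists p; rewrite ?inE // del_edge_adjr // eq_sym.
- by exists q; rewrite ?inE // del_edge_adjl // eq_sym.
- exists p; rewrite ?inE //; exists q; rewrite ?inE //.
  by apply: del_edge_adjl; rewrite // eq_sym.
Qed.

(** Deleting [w] leaves the side of [A] with [x] intact, deleting [a] leaves [B] intact. Every edge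
    between the two pieces ends in [x], so gluing along that single label represents [G]. *)
Lemma no_cut_vertex a b A B x w : separates a b A B -> x \in B -> w \in B ->
  w != x -> (forall y, y \in B -> adj a y || adj b y -> y = x) -> False.
Proof.
move=> sp xB wB wx only; apply: no_rep.
have /andP[aB bB] := sep_notB sp.
have outB y : y \in B -> y \notin side A a b by apply: side_mem sp.
have [t1 r1] := del_vert_rep w.
have [t2 r2] := del_vert_rep a.
have r1' : rep 2 t1 (x |: side A a b) (@adj G).
  apply: rep_sub r1 _ _ => //; apply/subsetP => y.
  rewrite [y \in [set~ w]]inE inE => /setU1P[->|yS]; first by rewrite eq_sym.
  by apply: contraTneq yS => ->; apply: outB.
have r2' : rep 2 t2 B (@adj G).
  apply: rep_sub r2 _ _ => //; apply/subsetP => y yB; rewrite !inE.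
  by apply: contraTneq yB => ->.
have R1 := rooted_at (isT : 0 < 2) r1' (setU11 _ _).
have R2 := rooted_at (isT : 0 < 2) r2' xB.
have [||||t rt] := rooted_glue _ _ _ _ R1 R2.
- by rewrite cards1.
- by rewrite sub1set setU11.
- by rewrite sub1set.
- apply/subsetP => y /setIP[/setU1P[->|yS] yB]; first by rewrite inE.
  by have := outB _ yB; rewrite yS.
exists t; apply: rep_sub rt _ _.
  apply/subsetP => y _; have := sep_cover sp y; rewrite !inE.
  by case/or4P => ->; rewrite ?orbT.
have crossing u y : adj u y -> u \in side A a b -> y \in B -> y = x.
  move=> uy uS yB; apply: only => //; move: uS uy; rewrite !inE.
  case/or3P => [uA|/eqP->|/eqP->] uy; rewrite ?uy ?orbT //.
  by rewrite (negPf (sep_noedge sp uA yB)) in uy.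
have cl y : (y \in side A a b) || (y \in B).
  by have := sep_cover sp y; rewrite !inE; case/or4P => ->; rewrite ?orbT.
move=> u v _ _ uv; rewrite uv /=; apply/orP; left; rewrite !in_setU1.
case/orP: (cl u) => hu; case/orP: (cl v) => hv; rewrite hu hv ?orbT //=.
- by rewrite (crossing _ _ uv hu hv) eqxx.
- by rewrite adj_sym in uv; rewrite (crossing _ _ uv hv hu) eqxx.
Qed.

Lemma iso_P3 a b A x : separates a b A [set x] -> ~~ adj a b ->
  iso (induced (side [set x] a b)) (path_graph 3).
Proof.
move=> sp nab.
have [_ /set1P-> ax] := sep_aB sp; have [_ /set1P-> bx] := sep_bB sp.
have nba : ~~ adj b a by rewrite adj_sym.
have := sep_notB sp; rewrite !inE => /andP[nax nbx].
apply: (@iso_path_seq _ _ [:: a; x; b] a).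
- by rewrite /= !inE negb_or nax (sep_ab sp) eq_sym nbx.
- by move=> y; rewrite !inE orbCA.
case=> [|[|[|i]]] // [|[|[|j]]] // _ _; rewrite /= ?adj_irrefl ?ax ?bx ?(negPf nab) ?(negPf nba) //;
  by rewrite adj_sym ?ax ?bx.
Qed.

Lemma iso_P4 a b A p q : separates a b A [set p; q] -> ~~ adj a b ->
  adj a p -> adj p q -> adj b q -> ~~ adj a q -> ~~ adj b p ->
  iso (induced (side [set p; q] a b)) (path_graph 4).
Proof.
move=> sp nab ap pq bq naq nbp.
have nba : ~~ adj b a by rewrite adj_sym.
have nqa : ~~ adj q a by rewrite adj_sym.
have npb : ~~ adj p b by rewrite adj_sym.
have pa : adj p a by rewrite adj_sym.
have qp : adj q p by rewrite adj_sym.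
have qb : adj q b by rewrite adj_sym.
have npq : p != q by apply: contraTneq pq => ->; rewrite adj_irrefl.
have := sep_notB sp; rewrite !inE !negb_or => /andP[/andP[e1 e2] /andP[e3 e4]].
apply: (@iso_path_seq _ _ [:: a; p; q; b] a).
- by rewrite /= !inE !negb_or e1 e2 (sep_ab sp) npq !(eq_sym _ b) e3 e4.
- move=> y; rewrite !inE; case: (y == a); rewrite ?orbT //=.
  by rewrite orbA.
by case=> [|[|[|[|i]]]] // [|[|[|[|j]]]] // _ _;
  rewrite /= ?adj_irrefl ?ap ?pq ?bq ?pa ?qp ?qb
    ?(negPf nab) ?(negPf nba) ?(negPf naq) ?(negPf nqa) ?(negPf nbp) ?(negPf npb).
Qed.

(** The roles cross here: the shape of [B] provides the proper minor whose representation yields the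
    edge for the side of [A]. If neither side is a short path, both are rooted and can be glued. *)
Lemma rooted_side a b A B : separates a b A B -> ~~ adj a b ->
  ~ iso (induced (side B a b)) (path_graph 3) ->
  ~ iso (induced (side B a b)) (path_graph 4) ->
  rooted 2 [set a; b] (side A a b) (@adj G).
Proof.
move=> sp nab nP3 nP4.
have [[p [q [pB qB ap bq pq]]]|none] := pselect (exists p q,
   [/\ p \in B, q \in B, adj a p, adj b q & p != q]); last first.
  (* Without distinct neighbours of [a] and [b], all neighbours of both in [B] are one vertex. *)
  have [p pB ap] := sep_aB sp; have [q qB bq] := sep_bB sp.
  have same_pq x y : x \in B -> y \in B -> adj a x -> adj b y -> x = y.
    by move=> xB yB ax bY; apply/eqP/negPn/negP => nxy; apply: none; exists x, y.
  have epq := same_pq _ _ pB qB ap bq; subst q.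
  have [eB|nB] := eqVneq B [set p].
    by case: nP3; rewrite eB in sp *; apply: iso_P3 sp nab.
  have [w wB wp] : exists2 w, w \in B & w != p.
    have /subsetPn[w wB] : ~~ (B \subset [set p]).
      rewrite subset1 negb_or nB; apply/set0Pn; by exists p.
    by rewrite inE; exists w.
  case: (no_cut_vertex sp pB wB wp) => y yB /orP[ay|bY].
    exact: same_pq ay bq.
  by apply/esym; apply: same_pq ap bY.
have [X [Y [pX qY dXY defB [cX cY]]]] :=
  cut_connected_split (@adj_sym G) (sep_connB sp) pB qB pq.
have [eX|nX] := eqVneq X [set p]; last first.
  by apply: (rooted_contract sp defB dXY cX cY pX ap) => //; exists q.
have [eY|nY] := eqVneq Y [set q]; last first.
  rewrite [[set a; b]]setUC; rewrite setUC in defB; rewrite disjoint_sym in dXY.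
  apply: (rooted_contract (separates_swap_ends sp) defB dXY cY cX qY bq) => //.
  by exists p.
(* No edge inside a part is left to contract. With [B] reduced to [p] and [q], its side is a path on
   four vertices unless [aq] or [bp] is a chord to delete. *)
have {}defB : B = [set p; q] by rewrite -defB eX eY.
have adj_pq : adj p q.
  have cB := sep_connB sp; have [||x /set1P-> [y]] := cB [set p].
  - by apply/set0Pn; exists p; rewrite inE.
  - rewrite properE sub1set pB /=; apply/subsetPn; exists q => //.
    by rewrite inE eq_sym.
  by rewrite defB !inE => /andP[/negPf-> /= /eqP->].
rewrite defB in sp nP3 nP4.
have [aq|naq] := boolP (adj a q).
  exact: (rooted_delete sp).
have [bp|nbp] := boolP (adj b p); last by case: nP4; apply: iso_P4 sp _ _ _ _ _ _.
rewrite [[set a; b]]setUC.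
rewrite [[set p; q]]setUC in sp; rewrite adj_sym in adj_pq.
exact: (rooted_delete (separates_swap_ends sp)).
Qed.

Lemma minimal_separation a b A B : separates a b A B ->
  ~~ adj a b /\
  ((iso (induced (side A a b)) (path_graph 3) \/
    iso (induced (side A a b)) (path_graph 4)) \/
   (iso (induced (side B a b)) (path_graph 3) \/
    iso (induced (side B a b)) (path_graph 4))).
Proof.
move=> sp; have nab := cut_pair_nonadjacent sp; split=> //.
apply: contrapT => /not_orP[/not_orP[A3 A4] /not_orP[B3 B4]].
have rA := rooted_side sp nab B3 B4.
have rB := rooted_side (separates_swap sp) nab A3 A4.
by apply: (glue_false sp _ rA rB) => u w ->.
Qed.

End TwoSeparation.

(** * The two components left by a 2-cut *)

Section Components.
Variables (G : sgraph) (a b : G).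

Lemma path_cross (T : eqType) (e : rel T) (Q : pred T) x p :
  path e x p -> Q x -> ~~ Q (last x p) ->
  exists y z, [/\ e y z, Q y, ~~ Q z & z \in p].
Proof.
elim: p x => [|y p IHp] x /= => [_ -> //|/andP[xy pp] Qx nQ].
have [Qy|nQy] := boolP (Q y); last by exists x, y; rewrite inE eqxx.
have [u [v [uv Qu Qv vp]]] := IHp y pp Qy nQ.
by exists u, v; rewrite inE vp orbT.
Qed.

Lemma connect_cross (T : finType) (e : rel T) (Q : pred T) x y :
  connect e x y -> Q x -> ~~ Q y ->
  exists u v, [/\ e u v, Q u, ~~ Q v & connect e x v].
Proof.
case/connectP => p pp -> Qx nQ; have [u [v [uv Qu Qv vp]]] := path_cross pp Qx nQ.
exists u, v; split=> //.
by apply: (path_connect pp); rewrite inE vp orbT.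
Qed.

Lemma components_separates (A B : {set del_verts [set a; b]}) :
  two_cut [set a; b] -> A != B ->
  components (del_verts [set a; b]) = [set A; B] ->
  separates a b (val @: A) (val @: B).
Proof.
set D := del_verts [set a; b] => -[c2 _ minS] nAB comps.
have nab : a != b by move: c2; rewrite cards2; case: (a != b).
have csym : connect_sym (@adj D) by apply: sym_connect_sym; apply: adj_sym.
have cls (X : {set D}) : X \in [set A; B] -> exists x, X = [set y | connect (@adj D) x y].
  rewrite -comps => /imsetP[x _ ->]; exists x.
  by apply/setP => y; rewrite !inE.
have [xA defA] : exists x, A = [set y | connect (@adj D) x y] by apply: cls; rewrite set21.
have [xB defB] : exists x, B = [set y | connect (@adj D) x y] by apply: cls; rewrite set22.
have AorB (z : D) : (z \in A) || (z \in B).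
  have : [set y | connect (@adj D) z y] \in [set A; B].
    rewrite -comps; apply/imsetP; exists z; rewrite ?inE //.
    by apply/setP => y; rewrite !inE.
  by case/set2P => <-; rewrite inE connect0 ?orbT.
have disj (z : D) : z \in A -> z \in B -> False.
  rewrite defA defB !inE => zA zB; case/eqP: nAB; rewrite defA defB.
  apply/setP => y; rewrite !inE; apply: same_connect => //.
  by apply: connect_trans zA _; rewrite csym.
have notS (z : D) : (val z != a) && (val z != b).
  by have := valP z; rewrite !inE negb_or.
have inD (x : G) : x != a -> x != b -> exists z : D, val z = x.
  move=> xa xb; have xP : x \in ~: [set a; b] by rewrite !inE negb_or xa.
  by exists (Sub x xP).
have memA (z : D) : (val z \in val @: A) = (z \in A) by rewrite mem_imset //; apply: val_inj.
have memB (z : D) : (val z \in val @: B) = (z \in B) by rewrite mem_imset //; apply: val_inj.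
have comp_conn (X : {set D}) x0 : X = [set y | connect (@adj D) x0 y] ->
    cut_connected (@adj G) (val @: X).
  move=> defX U /set0Pn[u uU] /properP[UX [w wX wU]].
  have /imsetP[u' u'X eu] := subsetP UX _ uU; case/imsetP: wX => w' w'X ew.
  have uw : connect (@adj D) u' w'.
    move: u'X w'X; rewrite defX !inE => xu xw; apply: connect_trans xw.
    by rewrite csym.
  subst u w; have [y [z [yz yU zU cz]]] := connect_cross (Q := fun z : D => val z \in U) uw uU wU.
  exists (val y) => //; exists (val z) => //; rewrite inE zU imset_f //.
  by move: u'X; rewrite defX !inE => xu; apply: connect_trans xu cz.
(* Minimality of the cut: deleting only [d] leaves a connected graph, so a path leads from [X] to
   [c]. The vertex by which it leaves [X] can only be [c], because any other would belong to the
   same component. *)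
have nbr (X : {set D}) x0 c d : X = [set y | connect (@adj D) x0 y] ->
    [set a; b] = [set c; d] -> c != d -> exists2 x, x \in val @: X & adj c x.
  move=> defX eab ncd.
  have memS (x : G) : (x \in [set a; b]) = (x == c) || (x == d) by rewrite eab !inE.
  have dS : [set d] \proper [set a; b].
    rewrite eab properE sub1set !inE eqxx orbT /=; apply/subsetPn; exists c.
      by rewrite !inE eqxx.
    by rewrite inE.
  have cP : c \in ~: [set d] by rewrite !inE.
  have x0S : val x0 \notin [set a; b] by have := valP x0; rewrite inE.
  have xP : val x0 \in ~: [set d].
    by move: x0S; rewrite memS !inE negb_or => /andP[].
  have x0X : x0 \in X by rewrite defX inE connect0.
  have := minS _ dS (Sub (val x0) xP) (Sub c cP).
  case/(connect_cross (Q := fun z : del_verts [set d] => val z \in val @: X)).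
  - by rewrite /= imset_f.
  - rewrite /=; apply/imsetP => -[z _ ez]; have := valP z.
    by rewrite inE memS (_ : val z = c) ?eqxx.
  move=> y [z [yz yX zX _]]; exists (val y) => //; rewrite adj_sym.
  suff <- : val z = c by [].
  apply/eqP; apply: contraNT zX => nzc.
  have nzd : val z != d by have := valP z; rewrite !inE.
  have zP : val z \in ~: [set a; b] by rewrite inE memS negb_or nzc.
  case/imsetP: yX => y' y'X ey.
  apply/imsetP; exists (Sub (val z) zP : D) => //.
  rewrite defX inE; move: y'X; rewrite defX inE => /connect_trans; apply.
  by apply: connect1; rewrite /= /induced_adj /= -ey.
have eba : [set a; b] = [set b; a] by rewrite setUC.
have nba : b != a by rewrite eq_sym.
have notin (X : {set D}) : (a \notin val @: X) && (b \notin val @: X).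
  by apply/andP; split; apply/imsetP => -[z _ ez]; have := notS z; rewrite -ez eqxx ?andbF.
split=> //.
- move=> x; have [//|xa] := eqVneq x a; have [//|xb] := eqVneq x b.
  by have [z <-] := inD _ xa xb; rewrite memA memB AorB.
- rewrite -setI_eq0; apply/eqP/setP => x; rewrite in_set0; apply/negP.
  case/setIP => /imsetP[z zA ->]; rewrite memB; exact: disj.
- move=> _ _ /imsetP[u uA ->] /imsetP[w wB ->]; apply/negP => uw.
  apply: (disj w) => //; move: uA; rewrite defA !inE => /connect_trans; apply.
  exact: connect1.
- exact: comp_conn defA.
- exact: comp_conn defB.
- exact: nbr defA erefl nab.
- exact: nbr defA eba nba.
- exact: nbr defB erefl nab.
- exact: nbr defB eba nba.
Qed.

End Components.

Lemma iso_refl (G : sgraph) : iso G G.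
Proof. by exists id; split=> //; exists id. Qed.

Unset Implicit Arguments.

Theorem lemma3p6 (G : sgraph)
  (not_3_connected : ~ k_connected 3 G)
  (mmw_ge3 : 3 <= mmw G)
  (mmw_minors : forall H : sgraph, proper_minor H G -> mmw H <= 2)
  (a b : G)
  (cut_ab : two_cut [set a; b])
  (A B : {set del_verts [set a; b]})
  (neq_AB : A != B)
  (comps : components (del_verts [set a; b]) = [set A; B]) :
  let tA := induced ((val @: A) :|: [set a; b]) in
  let tB := induced ((val @: B) :|: [set a; b]) in
  ~~ adj a b /\
  ((iso tA (path_graph 3) \/ iso tA (path_graph 4)) \/
   (iso tB (path_graph 3) \/ iso tB (path_graph 4))).
Proof.
have sp := components_separates cut_ab neq_AB comps.
have G2 : 1 < #|G|.
  by case: cut_ab => c2 _ _; rewrite -c2 max_card.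
apply: (minimal_separation _ _ sp).
- by case=> t /(rep_mmw G2) le2; have := leq_trans mmw_ge3 le2.
- move=> H GH; apply: mmw_rep => //; apply: mmw_minors.
  by exists H; split; [apply: Relation_Operators.t_step|apply: iso_refl].
Qed.
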